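(* Let $n\geq 1$. There exists an injective $*$-algebra map $$\pi : C(S^{n-1}_{\mathbb R,*}) \longrightarrow C(S_{\mathbb C}^{n-1}) \rtimes \mathbb Z_2,\qquad v_i \longmapsto z_i \otimes \tau \quad (1\leq i\leq n).$$
   Context: All $C^*$-algebras and $C^*$-algebra maps are unital. For $n\ge 1$, $C(S_{\mathbb R, *}^{n-1})$ (the algebra of the half-liberated real sphere) is the universal unital $C^*$-algebra generated by elements $v_1,\ldots,v_n$ subject to the relations $\sum_{i=1}^n v_i^2=1$, $v_i^*=v_i$, and $v_iv_jv_k=v_kv_jv_i$ for all $1\leq i,j,k\leq n$. $S^{n-1}_{\mathbb C}=\{z\in\mathbb C^n : \sum_i |z_i|^2=1\}$ is the complex sphere, $C(S^{n-1}_{\mathbb C})$ its algebra of continuous complex functions, and $z_1,\dots,z_n$ are the standard coordinate functions. Complex conjugation on $S^{n-1}_{\mathbb C}$ induces an order two automorphism $\tau$ of $C(S^{n-1}_{\mathbb C})$ with $\tau(z_i)=z_i^*$. The crossed product $C(S_{\mathbb C}^{n-1}) \rtimes \mathbb Z_2$ is with respect to $\tau$: its elements are uniquely written $f_0\otimes 1+f_1\otimes\tau$ with $f_0,f_1\in C(S^{n-1}_{\mathbb C})$, with product determined by $(f\otimes\tau)(g\otimes 1)=f\tau(g)\otimes\tau$, $(f\otimes\tau)(g\otimes\tau)=f\tau(g)\otimes 1$, $(f\otimes 1)(g\otimes\tau)=fg\otimes\tau$, $(f\otimes 1)(g\otimes 1)=fg\otimes 1$, and involution $(f\otimes 1)^*=f^*\otimes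 1$, $(f\otimes\tau)^*=\tau(f^* )\otimes\tau$. *)

(* Defs.v *)
From HB Require Import structures.
From mathcomp Require Import all_boot all_order all_algebra.
From mathcomp Require Import all_classical all_reals all_analysis.
From mathcomp Require Import complex.

Set Implicit Arguments.
Unset Strict Implicit.
Unset Printing Implicit Defensive.

Import Order.TTheory GRing.Theory Num.Theory.
Import numFieldNormedType.Exports.

Local Open Scope classical_set_scope.
Local Open Scope ring_scope.

(* Algebras are unital and satisfy [1 != 0], as usual in MathComp. *)
HB.mixin Record isStarAlgebra (K : numClosedFieldType) A
    of GRing.Algebra K A := {
  star : A -> A;
  starK : involutive star;
  starD : {morph star : x y / x + y};
  starM : forall x y : A, star (x * y) = star y * star x;
  starZ : forall (a : K) (x : A), star (a *: x) = a^* *: star x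
}.

#[short(type="starAlgType")]
HB.structure Definition StarAlgebra (K : numClosedFieldType) :=
  {A of GRing.Algebra K A & isStarAlgebra K A}.

HB.mixin Record isStarMorphism (K : numClosedFieldType) (A B : starAlgType K)
    (f : A -> B) := {
  starmorph : {morph f : x / star x}
}.

(* Being ring morphisms, *-morphisms preserve [1]. *)
HB.structure Definition StarMorphism (K : numClosedFieldType)
    (A B : starAlgType K) :=
  {f of @GRing.LRMorphism K A B *:%R f & isStarMorphism K A B f}.

Notation "{ 'starmorphism' A -> B }" := (StarMorphism.type A B)
  (at level 0, A at level 98, B at level 99,
   format "{ 'starmorphism'  A  ->  B }") : type_scope.

(* The norm is part of the structure: MathComp-Analysis' [NormedModule] has no
   join with [Algebra] in the hierarchy. *)
HB.mixin Record isCstarAlgebra (R : realType) A of StarAlgebra R[i] A := {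
  cnorm : A -> R;
  cnorm_eq0 : forall x : A, cnorm x = 0 -> x = 0;
  cnormD : forall x y : A, cnorm (x + y) <= cnorm x + cnorm y;
  cnormZ : forall (a : R[i]) (x : A), (cnorm (a *: x))%:C%C = `|a| * (cnorm x)%:C%C;
  cnormM : forall x y : A, cnorm (x * y) <= cnorm x * cnorm y;
  cnorm_star : forall x : A, cnorm (star x * x) = cnorm x ^+ 2;
  cnorm_complete : forall u : nat -> A,
    (forall e : R, 0 < e -> exists N : nat, forall m k : nat,
      (N <= m)%N -> (N <= k)%N -> cnorm (u m - u k) < e) ->
    exists l : A, forall e : R, 0 < e -> exists N : nat, forall m : nat,
      (N <= m)%N -> cnorm (u m - l) < e
}.

#[short(type="cstarAlgType")]
HB.structure Definition CstarAlgebra (R : realType) :=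
  {A of StarAlgebra R[i] A & isCstarAlgebra R A}.

Section HalfLiberatedSphere.
Variables (R : realType) (n : nat).

Definition half_liberated_relations (A : cstarAlgType R) (v : 'I_n -> A) :=
  [/\ \sum_(i < n) v i ^+ 2 = 1,
      forall i, star (v i) = v i
    & forall i j k, v i * v j * v k = v k * v j * v i].

(* [A] with [v] is the universal unital C*-algebra on [n] generators satisfying
   [half_liberated_relations]; it is determined up to unique isomorphism. *)
Definition is_half_liberated_sphere (A : cstarAlgType R) (v : 'I_n -> A) :=
  half_liberated_relations v /\
  forall (B : cstarAlgType R) (w : 'I_n -> B), half_liberated_relations w ->
    exists phi : {starmorphism A -> B},
      (forall i, phi (v i) = w i) /\
      (forall psi : {starmorphism A -> B},
        (forall i, psi (v i) = w i) -> psi =1 phi).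

End HalfLiberatedSphere.

Section ContinuousFunctions.
Variables (K : numClosedFieldType).

(* C(X), for K = R[i], with pointwise operations and the pointwise conjugate as
   involution. *)
Definition contfun (X : topologicalType) : Type := continuousType X K.

Section Lmod.
Variable (X : topologicalType).
Implicit Types f g h : contfun X.

HB.instance Definition _ := Choice.on (contfun X).

Definition contfun_fun f : X -> K := f.
Coercion contfun_fun : contfun >-> Funclass.

Lemma contfunP f g : f =1 g -> f = g.
Proof. by move=> fg; apply/continuousEP. Qed.

Lemma contfun_cts f : continuous (f : X -> K).
Proof. exact: cts_fun. Qed.

Definition mkcontfun (f : X -> K) (fc : continuous f) : contfun X :=
  (mkcts fc : continuousType X K).

Lemma contfun_zero_subproof : continuous (fun _ : X => 0 : K).
Proof. by move=> x; exact: cvg_cst. Qed.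

Lemma contfun_one_subproof : continuous (fun _ : X => 1 : K).
Proof. by move=> x; exact: cvg_cst. Qed.

Lemma contfun_opp_subproof f : continuous (fun x => - f x).
Proof. by move=> x; apply: cvgN; exact: contfun_cts. Qed.

Lemma contfun_add_subproof f g : continuous (fun x => f x + g x).
Proof. by move=> x; apply: cvgD; exact: contfun_cts. Qed.

Lemma contfun_mul_subproof f g : continuous (fun x => f x * g x).
Proof. by move=> x; apply: cvgM; exact: contfun_cts. Qed.

Lemma contfun_scale_subproof (a : K) f : continuous (fun x => a * f x).
Proof. by move=> x; apply: cvgM; [exact: cvg_cst | exact: contfun_cts]. Qed.

Lemma conjC_continuous : continuous (fun z : K => z^*).
Proof.
move=> z A [e /= e0 eA]; exists e => //= t /= zt; apply: eA => /=.
by rewrite -rmorphB norm_conjC.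
Qed.

Lemma contfun_star_subproof f : continuous (fun x => (f x)^*).
Proof.
move=> x; apply: (@continuous_comp _ _ _ f (fun z : K => z^*)).
  exact: contfun_cts.
exact: conjC_continuous.
Qed.

Definition contfun_zero := mkcontfun contfun_zero_subproof.
Definition contfun_one := mkcontfun contfun_one_subproof.
Definition contfun_opp f := mkcontfun (@contfun_opp_subproof f).
Definition contfun_add f g := mkcontfun (@contfun_add_subproof f g).
Definition contfun_mul f g := mkcontfun (@contfun_mul_subproof f g).
Definition contfun_scale a f := mkcontfun (@contfun_scale_subproof a f).
Definition contfun_star f := mkcontfun (@contfun_star_subproof f).

Lemma contfun_addA : associative contfun_add.
Proof. by move=> f g h; apply: contfunP => x; exact: addrA. Qed.
Lemma contfun_addC : commutative contfun_add.
Proof. by move=> f g; apply: contfunP => x; exact: addrC. Qed.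
Lemma contfun_add0 : left_id contfun_zero contfun_add.
Proof. by move=> f; apply: contfunP => x; exact: add0r. Qed.
Lemma contfun_addN : left_inverse contfun_zero contfun_opp contfun_add.
Proof. by move=> f; apply: contfunP => x; exact: addNr. Qed.

HB.instance Definition _ := GRing.isZmodule.Build (contfun X)
  contfun_addA contfun_addC contfun_add0 contfun_addN.

Lemma contfun_scaleA a b f :
  contfun_scale a (contfun_scale b f) = contfun_scale (a * b) f.
Proof. by apply: contfunP => x; exact: mulrA. Qed.
Lemma contfun_scale1 : left_id 1 contfun_scale.
Proof. by move=> f; apply: contfunP => x; exact: mul1r. Qed.
Lemma contfun_scaleDr : right_distributive contfun_scale +%R.
Proof. by move=> a f g; apply: contfunP => x; exact: mulrDr. Qed.
Lemma contfun_scaleDl f :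
  {morph contfun_scale^~ f : a b / a + b}.
Proof. by move=> a b; apply: contfunP => x; exact: mulrDl. Qed.

HB.instance Definition _ := GRing.Zmodule_isLmodule.Build K (contfun X)
  contfun_scaleA contfun_scale1 contfun_scaleDr contfun_scaleDl.

End Lmod.

Section Algebra.
Variable (X : ptopologicalType).
Implicit Types f g h : contfun X.

Lemma contfun_mulA : associative (@contfun_mul X).
Proof. by move=> f g h; apply: contfunP => x; exact: mulrA. Qed.
Lemma contfun_mulC : commutative (@contfun_mul X).
Proof. by move=> f g; apply: contfunP => x; exact: mulrC. Qed.
Lemma contfun_mul1 : left_id (contfun_one X) (@contfun_mul X).
Proof. by move=> f; apply: contfunP => x; exact: mul1r. Qed.
Lemma contfun_mulDl : left_distributive (@contfun_mul X) +%R.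
Proof. by move=> f g h; apply: contfunP => x; exact: mulrDl. Qed.
Lemma contfun_one_neq0 : contfun_one X != 0.
Proof.
apply/eqP => /(congr1 (fun f : contfun X => f point)) /eqP.
by rewrite (oner_eq0 K).
Qed.

HB.instance Definition _ := GRing.Zmodule_isComNzRing.Build (contfun X)
  contfun_mulA contfun_mulC contfun_mul1 contfun_mulDl contfun_one_neq0.

Lemma contfun_scaleAl (a : K) f g : a *: (f * g) = (a *: f) * g.
Proof. by apply: contfunP => x; exact: mulrA. Qed.

HB.instance Definition _ :=
  GRing.Lmodule_isLalgebra.Build K (contfun X) contfun_scaleAl.
Lemma contfun_scaleAr (a : K) f g : a *: (f * g) = f * (a *: g).
Proof. by apply: contfunP => x; exact: mulrCA. Qed.
HB.instance Definition _ :=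
  GRing.Lalgebra_isAlgebra.Build K (contfun X) contfun_scaleAr.

Lemma contfun_starK : involutive (@contfun_star X).
Proof. by move=> f; apply: contfunP => x; exact: conjCK. Qed.
Lemma contfun_starD : {morph @contfun_star X : f g / f + g}.
Proof. by move=> f g; apply: contfunP => x; exact: rmorphD. Qed.
Lemma contfun_starM f g :
  contfun_star (f * g) = contfun_star g * contfun_star f.
Proof.
by rewrite [RHS]mulrC; apply: contfunP => x; exact: rmorphM.
Qed.
Lemma contfun_starZ (a : K) f : contfun_star (a *: f) = a^* *: contfun_star f.
Proof. by apply: contfunP => x; exact: rmorphM. Qed.

HB.instance Definition _ := isStarAlgebra.Build K (contfun X)
  contfun_starK contfun_starD contfun_starM contfun_starZ.

End Algebra.
End ContinuousFunctions.

Section Pullback.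
Variables (K : numClosedFieldType) (X Y : ptopologicalType).
Variables (phi : X -> Y) (phi_cts : continuous phi).

Lemma pullback_subproof (f : contfun K Y) : continuous (fun x => f (phi x)).
Proof.
move=> x; apply: (@continuous_comp _ _ _ phi f); first exact: phi_cts.
exact: contfun_cts.
Qed.

Definition pullback (f : contfun K Y) : contfun K X :=
  mkcontfun (@pullback_subproof f).

Lemma pullback_is_linear : linear pullback.
Proof. by move=> a f g; exact: contfunP. Qed.
Lemma pullback_is_monoid_morphism : monoid_morphism pullback.
Proof. by split=> [|f g]; exact: contfunP. Qed.
Lemma pullback_star : {morph pullback : f / star f}.
Proof. by move=> f; exact: contfunP. Qed.

HB.instance Definition _ :=
  GRing.isLinear.Build K (contfun K Y) (contfun K X) *:%R pullback
    pullback_is_linear.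
HB.instance Definition _ :=
  GRing.isMonoidMorphism.Build (contfun K Y) (contfun K X) pullback
    pullback_is_monoid_morphism.
HB.instance Definition _ :=
  isStarMorphism.Build K (contfun K Y) (contfun K X) pullback pullback_star.

End Pullback.

Section ComplexSphere.
Variables (K : numClosedFieldType).

Definition complex_sphere (n : nat) : set 'rV[K]_n :=
  [set z | \sum_(i < n) `|z 0 i| ^+ 2 = 1].

(* The unit sphere of [K^(n+1)], with the topology induced by ['rV[K]_n.+1].
   It is never empty, so that [contfun] on it is a nonzero ring. *)
Definition csphere (n : nat) : Type := set_type (@complex_sphere n.+1).

HB.instance Definition _ n := Topological.copy (csphere n)
  (set_type (@complex_sphere n.+1)).

Lemma csphere_point_subproof n : (delta_mx 0 0 : 'rV[K]_n.+1)
  \in @complex_sphere n.+1.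
Proof.
rewrite inE /complex_sphere /= (bigD1 ord0) //= big1 => [|i /negPf i0].
  by rewrite mxE !eqxx normr1 expr1n addr0.
by rewrite mxE i0 andbF normr0 expr0n.
Qed.

HB.instance Definition _ n :=
  isPointed.Build (csphere n) 
    (exist (fun z => z \in @complex_sphere n.+1) _ (csphere_point_subproof n)).

Lemma csphere_conj_subproof n (z : csphere n) :
  map_mx Num.conj (set_val z) \in @complex_sphere n.+1.
Proof.
have zS : \sum_(i < n.+1) `|set_val z 0 i| ^+ 2 = 1 by exact: (set_valP z).
rewrite inE /complex_sphere /= -[RHS]zS.
by apply: eq_bigr => i _; rewrite mxE norm_conjC.
Qed.

Definition csphere_conj n (z : csphere n) : csphere n :=
  exist (fun z => z \in @complex_sphere n.+1) _ (csphere_conj_subproof z).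

Lemma set_val_csphere_continuous n :
  continuous (set_val : csphere n -> 'rV[K]_n.+1).
Proof. exact: initial_continuous. Qed.

Lemma map_mx_conj_continuous n :
  continuous (map_mx Num.conj : 'rV[K]_n -> 'rV[K]_n).
Proof.
move=> z A [P zP PA].
exists (fun i j => Num.conj @^-1` P i j) => [i j|w wP].
  by apply: conjC_continuous; have := zP i j; rewrite mxE.
by apply: PA => i j; rewrite mxE; exact: wP.
Qed.

Lemma csphere_conj_continuous n : continuous (@csphere_conj n).
Proof.
apply: continuous_comp_initial => z.
apply: (@continuous_comp _ _ _ set_val (map_mx Num.conj)).
  exact: set_val_csphere_continuous.
exact: map_mx_conj_continuous.
Qed.

Lemma ccoord_subproof n (i : 'I_n.+1) :
  continuous (fun z : csphere n => set_val z 0 i : K).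
Proof.
move=> z.
apply: (@continuous_comp _ _ _ set_val (fun w : 'rV[K]_n.+1 => w 0 i)).
  exact: set_val_csphere_continuous.
exact: coord_continuous.
Qed.

Definition ccoord n (i : 'I_n.+1) : contfun K (csphere n) :=
  mkcontfun (@ccoord_subproof n i).

(* f(z) |-> f(conj z); see [conj_autK] and [conj_aut_ccoord]. *)
Definition conj_aut n : {starmorphism contfun K (csphere n)
                                   -> contfun K (csphere n)} :=
  pullback (@csphere_conj_continuous n).

Lemma conj_autK n : involutive (@conj_aut n).
Proof.
move=> f; apply: contfunP => z; congr (f _); apply: val_inj.
by apply/matrixP => i j; rewrite !mxE conjCK.
Qed.

Lemma conj_aut_ccoord n i : @conj_aut n (ccoord i) = star (ccoord i).
Proof.
apply: contfunP => z.
have E : map_mx Num.conj (set_val z) 0 i = (set_val z 0 i)^* by rewrite mxE.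
exact: E.
Qed.

End ComplexSphere.

Section CrossedProduct.
Variables (K : numClosedFieldType) (A : starAlgType K).
Variable tau : {starmorphism A -> A}.

(* [Crossed _ f0 f1] stands for [f0 (x) 1 + f1 (x) tau]. *)
Record crossed_product (tauK : involutive tau) :=
  Crossed { coef1 : A; coef_tau : A }.

Variable tauK : involutive tau.
Local Notation AZ := (crossed_product tauK).
Local Notation crossed := (Crossed tauK).
Implicit Types x y z : AZ.

Definition tensor1 (f : A) : AZ := crossed f 0.
Definition tensor_tau (f : A) : AZ := crossed 0 f.

Definition pair_of_crossed x := (coef1 x, coef_tau x).
Definition crossed_of_pair (p : A * A) := crossed p.1 p.2.
Lemma pair_of_crossedK : cancel pair_of_crossed crossed_of_pair.
Proof. by case. Qed.

HB.instance Definition _ := Choice.copy AZ (can_type pair_of_crossedK).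

Lemma crossedP x y :
  coef1 x = coef1 y -> coef_tau x = coef_tau y -> x = y.
Proof. by case: x y => [? ?] [? ?] /= -> ->. Qed.

Definition crossed_zero : AZ := crossed 0 0.
Definition crossed_opp x : AZ := crossed (- coef1 x) (- coef_tau x).
Definition crossed_add x y : AZ :=
  crossed (coef1 x + coef1 y) (coef_tau x + coef_tau y).
Definition crossed_scale (a : K) x : AZ :=
  crossed (a *: coef1 x) (a *: coef_tau x).
Definition crossed_one : AZ := tensor1 1.
Definition crossed_mul x y : AZ :=
  crossed (coef1 x * coef1 y + coef_tau x * tau (coef_tau y))
          (coef1 x * coef_tau y + coef_tau x * tau (coef1 y)).
Definition crossed_star x : AZ :=
  crossed (star (coef1 x)) (tau (star (coef_tau x))).

Lemma crossed_addA : associative crossed_add.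
Proof. by move=> x y z; apply: crossedP; exact: addrA. Qed.
Lemma crossed_addC : commutative crossed_add.
Proof. by move=> x y; apply: crossedP; exact: addrC. Qed.
Lemma crossed_add0 : left_id crossed_zero crossed_add.
Proof. by move=> x; apply: crossedP; exact: add0r. Qed.
Lemma crossed_addN : left_inverse crossed_zero crossed_opp crossed_add.
Proof. by move=> x; apply: crossedP; exact: addNr. Qed.

HB.instance Definition _ := GRing.isZmodule.Build AZ
  crossed_addA crossed_addC crossed_add0 crossed_addN.

Lemma crossed_scaleA a b x :
  crossed_scale a (crossed_scale b x) = crossed_scale (a * b) x.
Proof. by apply: crossedP; exact: scalerA. Qed.
Lemma crossed_scale1 : left_id 1 crossed_scale.
Proof. by move=> x; apply: crossedP; exact: scale1r. Qed.
Lemma crossed_scaleDr : right_distributive crossed_scale +%R.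
Proof. by move=> a x y; apply: crossedP; exact: scalerDr. Qed.
Lemma crossed_scaleDl x : {morph crossed_scale^~ x : a b / a + b}.
Proof. by move=> a b; apply: crossedP; exact: scalerDl. Qed.

HB.instance Definition _ := GRing.Zmodule_isLmodule.Build K AZ
  crossed_scaleA crossed_scale1 crossed_scaleDr crossed_scaleDl.

Lemma crossed_mulA : associative crossed_mul.
Proof.
move=> x y z; apply: crossedP; rewrite /= !rmorphD !rmorphM /= !tauK;
  by rewrite !mulrDl !mulrDr !mulrA [X in _ + X = _]addrC addrACA.
Qed.
Lemma crossed_mul1 : left_id crossed_one crossed_mul.
Proof. by move=> x; apply: crossedP; rewrite /= mul1r mul0r addr0. Qed.
Lemma crossed_mulr1 : right_id crossed_one crossed_mul.
Proof.
move=> x; apply: crossedP; rewrite /= ?rmorph0 ?rmorph1 mulr1 mulr0.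
  by rewrite addr0.
by rewrite add0r.
Qed.
Lemma crossed_mulDl : left_distributive crossed_mul +%R.
Proof.
by move=> x y z; apply: crossedP; rewrite /= !mulrDl; exact: addrACA.
Qed.
Lemma crossed_mulDr : right_distributive crossed_mul +%R.
Proof.
move=> x y z; apply: crossedP; rewrite /= rmorphD !mulrDr; exact: addrACA.
Qed.
Lemma crossed_one_neq0 : crossed_one != 0.
Proof. by apply/eqP => -[] /eqP; rewrite oner_eq0. Qed.

HB.instance Definition _ := GRing.Zmodule_isNzRing.Build AZ
  crossed_mulA crossed_mul1 crossed_mulr1 crossed_mulDl crossed_mulDr
  crossed_one_neq0.

Lemma crossed_scaleAl (a : K) x y : a *: (x * y) = (a *: x) * y.
Proof. by apply: crossedP; rewrite /= scalerDr !scalerAl. Qed.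

HB.instance Definition _ :=
  GRing.Lmodule_isLalgebra.Build K AZ crossed_scaleAl.

Lemma crossed_scaleAr (a : K) x y : a *: (x * y) = x * (a *: y).
Proof. by apply: crossedP; rewrite /= linearZ scalerDr !scalerAr. Qed.

HB.instance Definition _ :=
  GRing.Lalgebra_isAlgebra.Build K AZ crossed_scaleAr.

Lemma crossed_starK : involutive crossed_star.
Proof. by move=> x; apply: crossedP; rewrite /= -?starmorph ?tauK starK. Qed.
Lemma crossed_starD : {morph crossed_star : x y / x + y}.
Proof. by move=> x y; apply: crossedP; rewrite /= starD ?rmorphD. Qed.
Lemma crossed_starM x y :
  crossed_star (x * y) = crossed_star y * crossed_star x.
Proof.
apply: crossedP; rewrite /= starD !starM ?rmorphD ?rmorphM /= -?starmorph
  ?tauK //.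
by rewrite addrC.
Qed.
Lemma crossed_starZ (a : K) x : crossed_star (a *: x) = a^* *: crossed_star x.
Proof. by apply: crossedP; rewrite /= starZ ?linearZ. Qed.

HB.instance Definition _ := isStarAlgebra.Build K AZ
  crossed_starK crossed_starD crossed_starM crossed_starZ.

Lemma crossedE x : x = tensor1 (coef1 x) + tensor_tau (coef_tau x).
Proof. by apply: crossedP; rewrite /= ?addr0 ?add0r. Qed.
Lemma tensor1M f g : tensor1 f * tensor1 g = tensor1 (f * g).
Proof. by apply: crossedP; rewrite /= ?rmorph0 ?mulr0 ?mul0r ?addr0. Qed.
Lemma tensor1_tauM f g : tensor1 f * tensor_tau g = tensor_tau (f * g).
Proof. by apply: crossedP; rewrite /= ?rmorph0 ?mulr0 ?mul0r ?addr0. Qed.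
Lemma tensor_tau1M f g : tensor_tau f * tensor1 g = tensor_tau (f * tau g).
Proof. by apply: crossedP; rewrite /= ?rmorph0 ?mulr0 ?mul0r ?addr0 ?add0r. Qed.
Lemma tensor_tauM f g : tensor_tau f * tensor_tau g = tensor1 (f * tau g).
Proof. by apply: crossedP; rewrite /= ?rmorph0 ?mulr0 ?mul0r ?addr0 ?add0r. Qed.
Lemma star_tensor1 f : star (tensor1 f) = tensor1 (star f).
Proof.
have star0 : star (0 : A) = 0.
  by have := starZ 0 (0 : A); rewrite rmorph0 !scale0r.
by apply: crossedP; rewrite /= ?star0 ?rmorph0.
Qed.
Lemma star_tensor_tau f : star (tensor_tau f) = tensor_tau (tau (star f)).
Proof.
have star0 : star (0 : A) = 0.
  by have := starZ 0 (0 : A); rewrite rmorph0 !scale0r.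
by apply: crossedP; rewrite /= ?star0.
Qed.

End CrossedProduct.

(* Main.v *)
Require Import Defs.
From HB Require Import structures.
From mathcomp Require Import all_boot all_order all_algebra.
From mathcomp Require Import all_classical all_reals all_analysis.
From mathcomp Require Import complex ring lra.

(* The images z_i (x) tau satisfy the half-liberated relations, and the crossed
   product is a C*-algebra (act on pairs of functions by 2x2 matrices, and take
   the supremum of the operator norms over the compact sphere), so pi exists by
   universality. For injectivity, A splits as even + odd along v_i |-> - v_i; pi
   sends even elements to f (x) 1 and odd ones to g (x) tau, so its kernel is
   graded, and it suffices to kill a kernel element of the form h = c^* c, which
   is even. The even part is the closed algebra generated by the v_i v_j, and it
   is commutative because (v_i v_j)(v_k v_l) = (v_k v_l)(v_i v_j). If h were
   nonzero, some character chi of the even part would not vanish at h. The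
   numbers p_ij = chi (v_i v_j) form a Hermitian matrix of trace 1 such that
   p_ij p_kl = p_kj p_il, hence p_ij = z_i z_j^* for a point z of the complex
   sphere, and chi is pi followed by evaluation at z; so chi h = 0.

   The character is obtained without Gelfand-Mazur, by a Kadison-Dubois argument:
   a preordering of the ring of self-adjoint elements that is maximal among those
   not containing -1 is total, and sup {r | a - r in Q} is a character. Its only
   analytic input is the existence of square roots of c - x for |x| < c. *)

Set Implicit Arguments.
Unset Strict Implicit.
Unset Printing Implicit Defensive.

Import Order.TTheory GRing.Theory Num.Theory.
Import numFieldNormedType.Exports.

Local Open Scope classical_set_scope.
Local Open Scope ring_scope.

(** * Characters of real commutative C*-algebras *)

(** Models the self-adjoint part of a commutative C*-algebra. No involution is left there, so the
    C*-identity enters through [rnorm_sqrD], which also encodes that squares are positive. *)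
Record real_cstar_norm (R : realType) (F : comNzRingType)
    (c : {rmorphism R -> F}) (N : F -> R) : Prop := RealCstarNorm {
  rnormD : forall x y, N (x + y) <= N x + N y;
  rnormZ : forall r x, N (c r * x) = `|r| * N x;
  rnormM : forall x y, N (x * y) <= N x * N y;
  rnorm_eq0 : forall x, N x = 0 -> x = 0;
  rnorm_complete : forall u : nat -> F,
    (forall e, 0 < e -> exists M, forall m k, (M <= m)%N -> (M <= k)%N ->
      N (u m - u k) < e) ->
    exists l, forall e, 0 < e -> exists M, forall m, (M <= m)%N ->
      N (u m - l) < e;
  rnorm_sqrD : forall a b t, 0 <= t -> a ^+ 2 + b ^+ 2 = c t -> N a ^+ 2 <= t
}.

(** * Inverses, square roots and sums of squares *)

Section RealCstar.
Variables (R : realType) (F : comNzRingType) (c : {rmorphism R -> F}).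
Variables (N : F -> R) (NF : real_cstar_norm c N).
Implicit Types (x y a b h : F) (r s t e : R) (Q : set F).

Lemma rnorm0 : N 0 = 0.
Proof. by have := rnormZ NF 0 0; rewrite mulr0 normr0 mul0r. Qed.

Lemma rnormN x : N (- x) = N x.
Proof. by have := rnormZ NF (-1) x; rewrite rmorphN1 mulN1r normrN1 mul1r. Qed.

Lemma rnorm_ge0 x : 0 <= N x.
Proof. by have := rnormD NF x (- x); rewrite subrr rnorm0 rnormN; lra. Qed.

Lemma rnormB x y : N (x - y) <= N x + N y.
Proof. by rewrite -(rnormN y); exact: (rnormD NF). Qed.

Lemma rnorm1_le1 : N 1 <= 1.
Proof.
have := @rnorm_sqrD _ _ _ _ NF 1 0 1.
rewrite expr1n expr0n addr0 rmorph1 => /(_ ler01 erefl).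
by rewrite expr_le1 ?rnorm_ge0.
Qed.

(** Banach's fixed point theorem on the closed ball of radius [rho] about 0, by iterating [G] from
    0. *)
Lemma contraction_fixpoint (G : F -> F) (rho r : R) :
  0 <= r < 1 -> 0 <= rho ->
  (forall y, N y <= rho -> N (G y) <= rho) ->
  (forall y z, N y <= rho -> N z <= rho -> N (G y - G z) <= r * N (y - z)) ->
  exists l, G l = l.
Proof.
move=> /andP[r0 r1] rho0 Grho Glip.
pose u k := iter k G 0.
have urho k : N (u k) <= rho.
  by elim: k => [|k IH]; [rewrite rnorm0 | exact: Grho].
have udist k m : N (u (k + m)%N - u k) <= r ^+ k * (rho + rho).
  elim: k => [|k IH].
    by rewrite expr0 mul1r (le_trans (rnormB _ _))// lerD.
  rewrite addSn exprS -mulrA (le_trans (Glip _ _ (urho _) (urho _)))//.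
  exact: ler_wpM2l.
have rk e : 0 < e -> exists M, forall k, (M <= k)%N -> r ^+ k * (rho + rho) < e.
  move=> e0; have : (fun k => r ^+ k * (rho + rho)) @ \oo --> (0 : R).
    rewrite -(mul0r (rho + rho)); apply: cvgM; last exact: cvg_cst.
    by apply: cvg_expr; rewrite ger0_norm.
  move=> /cvgr0_norm_lt /(_ _ e0) [M _ HM]; exists M => k Mk.
  exact: le_lt_trans (ler_norm _) (HM _ Mk).
have [l ul] : exists l, forall e, 0 < e -> exists M, forall m, (M <= m)%N ->
    N (u m - l) < e.
  apply: (rnorm_complete NF) => e e0; have [M HM] := rk _ e0; exists M.
  have H m k : (M <= k)%N -> (k <= m)%N -> N (u m - u k) < e.
    by move=> Mk km; rewrite -(subnKC km) (le_lt_trans (udist _ _))// HM.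
  move=> m k Mm Mk; case: (leqP k m) => [|/ltnW]; first exact: H.
  by rewrite -rnormN opprB; exact: H.
(* The limit stays in the closed ball, so the Lipschitz bound applies to it. *)
have lrho : N l <= rho.
  apply/ler_addgt0Pr => e e0; have [M /(_ M (leqnn _)) HM] := ul _ e0.
  have -> : l = u M - (u M - l) by ring.
  by rewrite (le_trans (rnormB _ _))// lerD ?urho// ltW.
exists l; apply/subr0_eq; apply: (rnorm_eq0 NF); apply/eqP.
rewrite eq_le rnorm_ge0 andbT; apply/ler_addgt0Pr => e e0; rewrite add0r.
have e20 : 0 < e / 2 by lra.
have [M HM] := ul _ e20.
have -> : G l - l = (u M.+1 - l) - (G (u M) - G l) by rewrite /u /=; ring.
rewrite (le_trans (rnormB _ _))//.
have H1 := HM _ (leqnn _); have H2 := HM _ (leqnSn M).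
have H3 := Glip _ _ (urho M) lrho.
have : r * N (u M - l) <= 1 * N (u M - l) by rewrite ler_wpM2r ?rnorm_ge0 ?ltW.
by lra.
Qed.

(** The inverse is the fixed point of [y |-> 1 + x * y]. The radius [(1 - N x)^-1] solves
    [N x * rho + 1 = rho], so the ball is preserved. *)
Lemma oneB_inv x : N x < 1 -> exists y, (1 - x) * y = 1.
Proof.
move=> x1; have x0 := rnorm_ge0 x.
have k0 : 0 < 1 - N x by lra.
have k1 : N x / (1 - N x) + 1 = (1 - N x)^-1 by field; rewrite gt_eqF.
have [|||y z _ _|y Hy] := @contraction_fixpoint (fun y => 1 + x * y) (1 - N x)^-1 (N x).
- by rewrite x0.
- by rewrite invr_ge0 ltW.
- move=> y yk; rewrite (le_trans (rnormD NF _ _))// -k1 addrC lerD ?rnorm1_le1//.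
  by rewrite (le_trans (rnormM NF _ _))// ler_wpM2l.
- have -> : 1 + x * y - (1 + x * z) = x * (y - z) by ring.
  exact: (rnormM NF).
- by exists y; rewrite mulrBl mul1r -[X in X - _ = _]Hy addrK.
Qed.

(* With [g = 1 - y] the equation reads [y = (x + y ^+ 2) / 2]. *)
Lemma oneB_sqrt x : N x < 1 -> exists g, g ^+ 2 = 1 - x.
Proof.
move=> x1; have x0 := rnorm_ge0 x.
pose k : F := c 2^-1; have k2 : k + k = 1.
  by rewrite -rmorphD -(rmorph1 c); congr (c _); lra.
have Nk z : N (k * z) = N z / 2.
  by rewrite (rnormZ NF) ger0_norm ?invr_ge0// mulrC.
(* The ball of radius [N x] is preserved since [N x + N x ^+ 2 <= 2 * N x]; on it [(y + z) / 2] has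
   norm at most [N x], the contraction constant. *)
have [|||y z yr zr|y Hy] :=
  @contraction_fixpoint (fun y => k * (x + y ^+ 2)) (N x) (N x).
- by rewrite x0.
- by [].
- move=> y yr; have y0 := rnorm_ge0 y; rewrite Nk.
  have := rnormD NF x (y ^+ 2); have := rnormM NF y y; rewrite -expr2.
  by nra.
- have -> : k * (x + y ^+ 2) - k * (x + z ^+ 2) = k * ((y + z) * (y - z)) by ring.
  rewrite Nk; have := rnormM NF (y + z) (y - z); have := rnormD NF y z.
  have := rnorm_ge0 (y - z); nra.
- exists (1 - y).
  have -> : 1 - x = (k + k) - ((k + k) * (x + y ^+ 2) - y ^+ 2) by rewrite k2; ring.
  by rewrite mulrDl Hy k2; ring.
Qed.

Lemma cst_sub_sqrt x t : N x < t -> exists g, g ^+ 2 = c t - x.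
Proof.
move=> xt; have t0 : 0 < t by exact: le_lt_trans (rnorm_ge0 x) xt.
have [|g Hg] := @oneB_sqrt (c t^-1 * x).
  by rewrite (rnormZ NF) gtr0_norm ?invr_gt0// mulrC ltr_pdivrMr ?mul1r.
exists (c (Num.sqrt t) * g).
rewrite exprMn -rmorphXn /= sqr_sqrtr ?ltW// Hg mulrBr mulr1 mulrA -rmorphM.
by rewrite divff ?gt_eqF// rmorph1 mul1r.
Qed.

Inductive sos : F -> Prop :=
| sos0 : sos 0
| sosD_sqr x a : sos x -> sos (x + a ^+ 2).

Definition preordering Q := [/\ forall x y, Q x -> Q y -> Q (x + y),
  forall x y, Q x -> Q y -> Q (x * y) & forall a, Q (a ^+ 2)].

Lemma preordering_sos : preordering sos.
Proof.
have sD x y : sos x -> sos y -> sos (x + y).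
  move=> sx; elim=> [|s a _ IH]; first by rewrite addr0.
  by rewrite addrA; exact: sosD_sqr.
split => //; last by move=> a; rewrite -[_ ^+ 2]add0r; exact/sosD_sqr/sos0.
move=> x y sx; elim=> [|s a _ IH]; first by rewrite mulr0; exact: sos0.
rewrite mulrDr; apply: sD => //.
elim: sx => [|s' a' _ IH']; first by rewrite mul0r; exact: sos0.
by rewrite mulrDl -exprMn; exact: sosD_sqr.
Qed.

(** The preordering generated by [Q] and [a]: squares lie in [Q], so no power of [a] beyond the
    first is needed. *)
Definition adjoin Q a x := exists y z : F, [/\ Q y, Q z & x = y + z * a].

Lemma preordering_adjoin Q a : preordering Q -> preordering (adjoin Q a).
Proof.
move=> [QD QM Q2]; split.
- move=> _ _ [s [t [Qs Qt ->]]] [s' [t' [Qs' Qt' ->]]].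
  by exists (s + s'), (t + t'); split; [exact: QD|exact: QD|ring].
- move=> _ _ [s [t [Qs Qt ->]]] [s' [t' [Qs' Qt' ->]]].
  exists (s * s' + t * t' * a ^+ 2), (s * t' + t * s'); split; last by ring.
    by apply: QD; [exact: QM|apply: (QM) => //; exact: QM].
  by apply: QD; exact: QM.
- move=> b; exists (b ^+ 2), (0 ^+ 2); split => //; ring.
Qed.

Lemma sub_adjoin Q a x : preordering Q -> Q x -> adjoin Q a x.
Proof. by move=> [_ _ Q2] Qx; exists x, (0 ^+ 2); split => //; ring. Qed.

Lemma mem_adjoin Q a : preordering Q -> adjoin Q a a.
Proof. by move=> [_ _ Q2]; exists (0 ^+ 2), (1 ^+ 2); split => //; ring. Qed.

(** Positivity expressed by the norm. For a single square, [c r - a ^+ 2] is a square [g ^+ 2], and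
    [g ^+ 2 + a ^+ 2 = c r] bounds it by [r]. *)
Lemma sos_bound x : sos x -> exists2 t, 0 <= t & N (c t - x) <= t.
Proof.
elim=> [|s' a _ [t t0 Ht]].
  by exists 0; rewrite // rmorph0 subrr rnorm0.
(* The added 1 gives the strict inequality that [cst_sub_sqrt] requires. *)
pose r := N a ^+ 2 + 1; have r0 : 0 <= r by rewrite addr_ge0// sqr_ge0.
have [|g Hg] := @cst_sub_sqrt (a ^+ 2) r.
  by rewrite (le_lt_trans (rnormM NF _ _))// -expr2 /r; lra.
exists (t + r); first exact: addr_ge0.
have -> : c (t + r) - (s' + a ^+ 2) = (c t - s') + (c r - a ^+ 2) by ring.
rewrite (le_trans (rnormD NF _ _))// lerD// -Hg.
rewrite (le_trans (rnormM NF _ _))// -expr2.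
by apply: (rnorm_sqrD NF (b := a)); rewrite // Hg subrK.
Qed.

(** Factor [1 + x] as [(t + 1) * (1 - (t - x) / (t + 1))], where the quotient has norm less than 1
    by [sos_bound]. *)
Lemma sos_oneD_inv x : sos x -> exists y, (1 + x) * y = 1.
Proof.
move=> /sos_bound[t t0 Ht]; have t10 : 0 < t + 1 by lra.
have [|y Hy] := @oneB_inv (c (t + 1)^-1 * (c t - x)).
  by rewrite (rnormZ NF) gtr0_norm ?invr_gt0// mulrC ltr_pdivrMr// mul1r; lra.
exists (c (t + 1)^-1 * y); rewrite -[RHS]Hy mulrA; congr (_ * y).
have k1 : c (t + 1)^-1 * (c t + 1) = 1.
  by rewrite -[X in c t + X](rmorph1 c) -rmorphD -rmorphM mulVf ?gt_eqF// rmorph1.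
by rewrite -[X in _ = X - _]k1; ring.
Qed.

(** Although [x] need not be a square, [x + c e] is one for every [e > 0]; apply [rnorm_sqrD] to it
    and let [e] tend to 0. *)
Lemma sqr_sos_bound h x t : 0 <= t -> sos x -> h ^+ 2 + x = c t -> N h ^+ 2 <= t.
Proof.
move=> t0 /sos_bound[T T0 HT] hst; apply/ler_addgt0Pr => e e0.
have [|g Hg] := @cst_sub_sqrt (c T - x) (T + e); first by lra.
apply: (rnorm_sqrD NF (b := g)); first exact: addr_ge0 (ltW e0).
by rewrite Hg [RHS]rmorphD -hst; ring.
Qed.

(** * The character defined by a maximal preordering *)

Section MaximalPreordering.
Variable Q : set F.
Hypotheses (preQ : preordering Q) (QN1 : ~ Q (- 1)).
Hypothesis maxQ : forall Q', preordering Q' -> Q `<=` Q' -> ~ Q' (- 1) ->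
  Q' `<=` Q.

Let QD x y : Q x -> Q y -> Q (x + y). Proof. by case: preQ => H _ _; exact: H. Qed.
Let QM x y : Q x -> Q y -> Q (x * y). Proof. by case: preQ => _ H _; exact: H. Qed.
Let Q2 a : Q (a ^+ 2). Proof. by case: preQ. Qed.

Let Qc r : 0 <= r -> Q (c r).
Proof. by move=> r0; rewrite -(sqr_sqrtr r0) rmorphXn; exact: Q2. Qed.

Let QcN r : r < 0 -> ~ Q (c r).
Proof.
move=> r0 Qr; apply: QN1; have : Q (c (- r)^-1 * c r).
  by apply: QM => //; apply: Qc; rewrite invr_ge0; lra.
rewrite -rmorphM; have -> : (- r)^-1 * r = -1 by field; rewrite lt_eqF.
by rewrite rmorphN1.
Qed.

(** Otherwise maximality gives [-1 = s + t * a] and [-1 = s' - t' * a]. Multiplying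
    [t * a = - (1 + s)] by [t' * a = 1 + s'] exhibits [-1] as [s + s' + s * s' + t * t' * a ^+ 2],
    an element of [Q]. *)
Let Q_total a : Q a \/ Q (- a).
Proof.
have H b : ~ Q b -> adjoin Q b (- 1).
  move=> Qb; apply: contrapT => nadj; apply: Qb.
  apply: (maxQ (preordering_adjoin b preQ)) => //; last exact: mem_adjoin.
  by move=> x; exact: sub_adjoin.
have [|/H[s [t [Qs Qt E1]]]] := pselect (Q a); first by left.
have [|/H[s' [t' [Qs' Qt' E2]]]] := pselect (Q (- a)); first by right.
case: QN1; have -> : - 1 = s + s' + s * s' + t * t' * a ^+ 2.
  have Ea : t * a = - 1 - s by rewrite E1; ring.
  have Ea' : t' * a = 1 + s' by rewrite -[1]opprK E2; ring.
  have -> : t * t' * a ^+ 2 = (t * a) * (t' * a) by ring.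
  by rewrite Ea Ea'; ring.
apply: QD; last by apply: QM => //; exact: QM.
by apply: QD; [exact: QD|exact: QM].
Qed.

Let Q_norm a r : N a < r -> Q (c r - a).
Proof. by move=> /cst_sub_sqrt[g <-]. Qed.

(** The graph of the character: for the order given by [Q], [a] and [c t] differ by less than any
    positive constant. In relational form the algebraic laws can be checked without handling
    suprema. *)
Definition is_value a t :=
  forall e, 0 < e -> Q (a - c t + c e) /\ Q (c t - a + c e).

Lemma is_value_unique a s t : is_value a s -> is_value a t -> s = t.
Proof.
have H s' t' : is_value a s' -> is_value a t' -> s' <= t'.
  move=> As At; rewrite leNgt; apply/negP => st.
  have e0 : 0 < (s' - t') / 4 by lra.
  have [Q1 _] := As _ e0; have [_ Q3] := At _ e0.
  apply: (@QcN ((t' - s') / 2)); first by lra.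
  have := QD Q1 Q3; congr (Q _).
  have -> : (t' - s') / 2 = t' - s' + ((s' - t') / 4 + (s' - t') / 4) by lra.
  by rewrite !rmorphD rmorphN /=; ring.
by move=> As At; apply/eqP; rewrite eq_le !H.
Qed.

(** The value is the supremum of [S], which [Q_norm] shows to be nonempty and bounded. The lower
    estimate comes from elements of [S] near the supremum, the upper one from [Q_total], as
    [sup S + e] is outside [S]. *)
Lemma is_value_exists a : exists t, is_value a t.
Proof.
pose S := [set r : R | Q (a - c r)].
have ubS : ubound S (N a + 1).
  move=> r /= Qr; rewrite leNgt; apply/negP => Nar.
  apply: (@QcN (N a + 1 - r)); first by lra.
  rewrite rmorphB /=; have -> : c (N a + 1) - c r = (c (N a + 1) - a) + (a - c r).
    by ring.
  by apply: QD => //; apply: Q_norm; lra.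
have S0 : S !=set0.
  exists (- (N a + 1)); rewrite /S /= rmorphN opprK addrC -[X in _ + X]opprK.
  by apply: Q_norm; rewrite rnormN; lra.
have supS : has_sup S by split => //; exists (N a + 1).
exists (sup S) => e e0; split.
  have [r Sr rS] := sup_adherent e0 supS.
  have -> : a - c (sup S) + c e = (a - c r) + c (r - sup S + e).
    by rewrite !rmorphD rmorphN /=; ring.
  by apply: QD => //; apply: Qc; lra.
have [QS|] := Q_total (a - c (sup S + e)).
  have : sup S + e <= sup S by apply: sup_upper_bound.
  by lra.
by congr (Q _); rewrite rmorphD /=; ring.
Qed.

Lemma is_valueD a b s t : is_value a s -> is_value b t -> is_value (a + b) (s + t).
Proof.
move=> As Bt e e0; have e20 : 0 < e / 2 by lra.
have [A1 A2] := As _ e20; have [B1 B2] := Bt _ e20.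
have ee : c e = c (e / 2) + c (e / 2) by rewrite -rmorphD; congr (c _); lra.
split; [have := QD A1 B1|have := QD A2 B2];
  by congr (Q _); rewrite ee rmorphD /=; ring.
Qed.

Lemma is_value_cst r : is_value (c r) r.
Proof. by move=> e e0; rewrite subrr add0r; split; apply: Qc; exact: ltW. Qed.

Lemma is_valueN a s : is_value a s -> is_value (- a) (- s).
Proof.
by move=> As e /As[A1 A2]; split; [move: A2|move: A1]; congr (Q _);
  rewrite rmorphN /=; ring.
Qed.

Lemma is_valueZ r a s : is_value a s -> is_value (c r * a) (r * s).
Proof.
have pos r' a' s' : 0 < r' -> is_value a' s' -> is_value (c r' * a') (r' * s').
  move=> r0 As e e0; have [|A1 A2] := As (e / r'); first exact: divr_gt0.
  have re : c e = c r' * c (e / r') by rewrite -rmorphM mulrC divfK ?gt_eqF.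
  by split; [have := QM (Qc (ltW r0)) A1|have := QM (Qc (ltW r0)) A2];
    congr (Q _); rewrite re rmorphM /=; ring.
case: (ltrgtP r 0) => [r0|r0|->] As; last 2 first.
- exact: pos.
- by rewrite rmorph0 !mul0r -(rmorph0 c); exact: is_value_cst.
rewrite -[r * s]opprK -mulNr -[c r * a]opprK -mulNr -rmorphN.
by apply/is_valueN/pos => //; lra.
Qed.

(** With [e = d ^+ 2], the element [c e - a ^+ 2] is the product of [c d + a] and [c d - a], both in
    [Q]. *)
Lemma is_value0_sqr a : is_value a 0 -> is_value (a ^+ 2) 0.
Proof.
move=> A e e0.
have [] := A (Num.sqrt e); rewrite ?sqrtr_gt0// rmorph0 subr0 sub0r => A1 A2.
rewrite subr0 sub0r; split; first by apply: QD => //; apply/Qc/ltW.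
have := QM A1 A2; congr (Q _).
rewrite -[e in RHS](sqr_sqrtr (ltW e0)) rmorphXn /=; ring.
Qed.

Lemma is_valueM a b s t : is_value a s -> is_value b t -> is_value (a * b) (s * t).
Proof.
move=> As Bt.
(* Polarization: [2 * x * y = (x + y) ^+ 2 - (x ^+ 2 + y ^+ 2)] reduces products to squares when
   both values are 0. *)
have H x y : is_value x 0 -> is_value y 0 -> is_value (x * y) 0.
  move=> X Y; have XY := is_valueD X Y; rewrite addr0 in XY.
  have := is_valueD (is_value0_sqr XY)
    (is_valueN (is_valueD (is_value0_sqr X) (is_value0_sqr Y))).
  rewrite addr0 oppr0 addr0 => /(is_valueZ 2^-1); rewrite mulr0.
  congr is_value.
  have -> : (x + y) ^+ 2 - (x ^+ 2 + y ^+ 2) = c 2 * (x * y).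
    by rewrite rmorph_nat; ring.
  by rewrite mulrA -rmorphM mulVf ?rmorph1 ?mul1r// pnatr_eq0.
have sub x r : is_value x r -> is_value (x - c r) 0.
  by move=> X; rewrite -(subrr r); apply/(is_valueD X)/is_valueN/is_value_cst.
(* Expand [a * b = (a - s) * (b - t) + s * b + t * a - s * t]. *)
have := is_valueD (H _ _ (sub _ _ As) (sub _ _ Bt))
  (is_valueD (is_valueD (is_valueZ s Bt) (is_valueZ t As)) (is_value_cst (- (s * t)))).
congr is_value; last by ring.
by rewrite rmorphN rmorphM /=; ring.
Qed.

Lemma is_value_norm a t : is_value a t -> `|t| <= N a.
Proof.
have H x r : is_value x r -> r <= N x.
  move=> X; apply/ler_addgt0Pr => e e0; rewrite leNgt; apply/negP => xr.
  have e20 : 0 < (r - N x - e) / 2 by lra.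
  have [X1 _] := X _ e20; have Xe := @Q_norm x (N x + e) ltac:(lra).
  apply: (@QcN ((N x + e - r) / 2)); first by lra.
  have := QD X1 Xe; congr (Q _).
  have -> : (N x + e - r) / 2 = (N x + e) - r + (r - N x - e) / 2 by lra.
  by rewrite !rmorphD rmorphN /=; ring.
move=> A; rewrite ler_norml H// andbT -(rnormN a).
by rewrite lerNl; apply/H/is_valueN.
Qed.

Lemma is_value_ge0 a t : Q a -> is_value a t -> 0 <= t.
Proof.
move=> Qa A; rewrite leNgt; apply/negP => t0.
have [|_ A2] := A (- t / 2); first by lra.
apply: (@QcN (t / 2)); first by lra.
have := QD Qa A2; congr (Q _).
have -> : t / 2 = t + - t / 2 by lra.
by rewrite !rmorphD /=; ring.
Qed.

End MaximalPreordering.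

(** * Existence of maximal preorderings and of characters *)

Lemma maximal_preordering Q0 : preordering Q0 -> ~ Q0 (- 1) ->
  exists Q, [/\ preordering Q, Q0 `<=` Q, ~ Q (- 1) &
    forall Q', preordering Q' -> Q `<=` Q' -> ~ Q' (- 1) -> Q' `<=` Q].
Proof.
move=> preQ0 Q0N1.
pose P Q := Q = set0 \/ [/\ preordering Q, Q0 `<=` Q & ~ Q (- 1)].
have [|Q [[Q0E|[preQ Q0Q QN1]] Qmax]] := @Zorn_bigcup F P.
- move=> C CP Ctot.
  have [[X CX X0]|Cempty] := pselect (exists2 X, C X & X != set0); last first.
    left; rewrite -subset0 => x [X CX Xx]; apply: Cempty; exists X => //.
    by apply/set0P; exists x.
  have CPn Y : C Y -> Y !=set0 -> [/\ preordering Y, Q0 `<=` Y & ~ Y (- 1)].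
    by move=> /CP[->|//] [].
  have /CPn - /(_ CX) [[_ _ X2] Q0X _] : X !=set0 by exact/set0P.
  right; split.
  + have common x y : (\bigcup_(X in C) X) x -> (\bigcup_(X in C) X) y ->
        exists Y, [/\ C Y, Y x, Y y & preordering Y].
      move=> [Y CY Yx] [Z CZ Zy].
      have [preY _ _] := CPn Y CY (ex_intro _ x Yx).
      have [preZ _ _] := CPn Z CZ (ex_intro _ y Zy).
      have [YZ|ZY] := Ctot Y Z CY CZ; [exists Z|exists Y]; split => //.
        exact: YZ.
      exact: ZY.
    split => [x y Cx Cy|x y Cx Cy|a]; last by exists X.
      by have [Y [CY Yx Yy [YD _ _]]] := common x y Cx Cy; exists Y => //; exact: YD.
    by have [Y [CY Yx Yy [_ YM _]]] := common x y Cx Cy; exists Y => //; exact: YM.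
  + by move=> x /Q0X; exists X.
  + by move=> [Y CY YN1]; have [] := CPn Y CY (ex_intro _ _ YN1).
(* The maximal element is not empty, since [Q0] contains [1 ^+ 2]. *)
- case: (Qmax Q0); last by right; split.
  by rewrite Q0E; split=> [x []//|/(_ (1 ^+ 2)) []]; case: preQ0.
exists Q; split => // Q' preQ' QQ' Q'N1; apply: contrapT => Q'Q.
by apply: (Qmax Q'); [split|right; split => //; exact: subset_trans QQ'].
Qed.

(** The preordering is made to contain [q = h ^+ 2 - c k], so that [chi h = 0] would give
    [chi q = - k < 0]. Adjoining [q] to the sums of squares is consistent because [k] is half of
    [N h ^+ 2]. *)
Theorem real_character h : h <> 0 -> exists chi : F -> R,
  [/\ {morph chi : x y / x + y}, {morph chi : x y / x * y},
      forall r, chi (c r) = r, forall x, `|chi x| <= N x & chi h != 0].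
Proof.
move=> h0; have Nh : 0 < N h.
  by rewrite lt0r rnorm_ge0 andbT; apply/eqP => /(rnorm_eq0 NF).
pose k := N h ^+ 2 / 2; have k0 : 0 < k by rewrite divr_gt0// exprn_gt0.
pose q := h ^+ 2 - c k.
have [sosD sosM sosX] := preordering_sos.
have preQ0 := preordering_adjoin q preordering_sos.
have Q0N1 : ~ adjoin sos q (- 1).
  move=> [s [t [ss st E]]].
  have [y Hy] := sos_oneD_inv ss.
  have Eq : t * q = - (1 + s) by rewrite opprD E; ring.
  (* From [t * q = - (1 + s)] and [(1 + s) * y = 1] one gets [- q = q ^+ 2 * t * y], and
     [y = (1 + s) * y ^+ 2] is a sum of squares. Hence [c k = h ^+ 2 - q] is [h ^+ 2] plus a sum of
     squares. *)
  have : N h ^+ 2 <= k.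
    apply: (@sqr_sos_bound _ (q ^+ 2 * t * ((1 + s) * y ^+ 2))); first exact: ltW.
      apply: (sosM); first exact: (sosM).
      by apply: (sosM) => //; apply: sosD => //; rewrite -(expr1n _ 2); exact: sosX.
    have -> : q ^+ 2 * t * ((1 + s) * y ^+ 2) = q * (t * q) * y * ((1 + s) * y).
      by ring.
    rewrite Hy Eq mulr1; have -> : q * - (1 + s) * y = - q * ((1 + s) * y) by ring.
    by rewrite Hy /q; ring.
  by have : 0 < N h ^+ 2; [exact: exprn_gt0|rewrite /k; lra].
have [Q [preQ Q0Q QN1 maxQ]] := maximal_preordering preQ0 Q0N1.
have [chi chiP] := choice (is_value_exists preQ QN1 maxQ).
have chiE x t : is_value Q x t -> chi x = t.
  by move=> xt; apply: (is_value_unique preQ QN1 _ xt); exact: chiP.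
exists chi; split.
- by move=> x y; apply: chiE; exact: (is_valueD preQ (chiP x) (chiP y)).
- move=> x y; apply: chiE.
  exact: (is_valueM preQ (chiP x) (chiP y)).
- by move=> r; apply: chiE; exact: (is_value_cst preQ).
- by move=> x; apply: (is_value_norm preQ QN1 (chiP x)).
- apply/eqP => hE.
  have Qq : Q q by apply/Q0Q/mem_adjoin/preordering_sos.
  have := is_value_ge0 preQ QN1 Qq (chiP q).
  suff -> : chi q = - k by lra.
  apply: chiE.
  have := is_valueD preQ (is_valueM preQ (chiP h) (chiP h)) (is_value_cst preQ (- k)).
  by rewrite hE mul0r add0r rmorphN -expr2.
Qed.

End RealCstar.

(** * C*-subalgebras and *-morphisms *)

Section StarAlgebraTheory.
Variables (K : numClosedFieldType) (A : starAlgType K).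
Implicit Types x y : A.

Lemma star0 : star (0 : A) = 0.
Proof. by have := starZ 0 (0 : A); rewrite rmorph0 !scale0r. Qed.

Lemma starN x : star (- x) = - star x.
Proof. by rewrite -scaleN1r starZ rmorphN1 scaleN1r. Qed.

Lemma starB x y : star (x - y) = star x - star y.
Proof. by rewrite starD starN. Qed.

Lemma star1 : star (1 : A) = 1.
Proof. by have := starM (star 1) (1 : A); rewrite mulr1 starK mulr1. Qed.

End StarAlgebraTheory.

(** * Consequences of the C*-identity *)

Section CstarAlgebraTheory.
Variables (R : realType) (A : cstarAlgType R).
Implicit Types (x y a b : A) (r t : R).

Lemma normc_real r : `|r%:C%C| = `|r|%:C%C :> R[i].
Proof. by rewrite normc_def /= expr0n addr0 sqrtr_sqr. Qed.

Lemma conjc_real r : Num.conj r%:C%C = r%:C%C :> R[i].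
Proof. by apply/eqP; rewrite eq_complex /= oppr0 !eqxx. Qed.

Lemma cnormZ_real r x : cnorm (r%:C%C *: x) = `|r| * cnorm x.
Proof. by apply: complexI; rewrite cnormZ normc_real rmorphM. Qed.

Lemma star_scale_real r x : star (r%:C%C *: x) = r%:C%C *: star x.
Proof. by rewrite starZ; congr (_ *: _); exact: conjc_real. Qed.

Lemma cnorm0 : cnorm (0 : A) = 0.
Proof. by have := cnormZ_real 0 (0 : A); rewrite scaler0 normr0 mul0r. Qed.

Lemma cnormN x : cnorm (- x) = cnorm x.
Proof.
by have := cnormZ_real (- 1) x; rewrite rmorphN1 scaleN1r normrN1 mul1r.
Qed.

Lemma cnorm_ge0 x : 0 <= cnorm x.
Proof. by have := cnormD x (- x); rewrite subrr cnorm0 cnormN; lra. Qed.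

Lemma cnormB x y : cnorm (x - y) <= cnorm x + cnorm y.
Proof. by rewrite -(cnormN y) cnormD. Qed.

Lemma cnormBC x y : cnorm (x - y) = cnorm (y - x).
Proof. by rewrite -cnormN opprB. Qed.

Lemma cnorm_starE x : cnorm (star x) = cnorm x.
Proof.
suff H y : cnorm y <= cnorm (star y).
  by apply/eqP; rewrite eq_le H andbT -{2}[x]starK H.
have := cnormM (star y) y; rewrite cnorm_star.
have := cnorm_ge0 y; rewrite le_eqVlt => /predU1P[<- _|y0].
  exact: cnorm_ge0.
by rewrite expr2 ler_pM2r.
Qed.

Lemma cnorm1 : cnorm (1 : A) = 1.
Proof.
have n0 : cnorm (1 : A) != 0 by apply/eqP => /cnorm_eq0/eqP; rewrite oner_eq0.
have := cnorm_star (1 : A); rewrite star1 mul1r expr2.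
by rewrite -{1}[cnorm 1]mulr1 => /(mulfI n0).
Qed.

Lemma normc_i : `|'i%C| = 1 :> R[i].
Proof. by rewrite normc_def /= expr0n expr1n add0r sqrtr1. Qed.

Lemma conjc_i : Num.conj 'i%C = - 'i%C :> R[i].
Proof. by apply/eqP; rewrite eq_complex /= oppr0 !eqxx. Qed.

(* The element [u = a + i b] satisfies [star u * u = t], and [a] is its real part. *)
Lemma cnorm_sqrD a b t : 0 <= t -> star a = a -> star b = b -> a * b = b * a ->
  a ^+ 2 + b ^+ 2 = t%:C%C *: 1 -> cnorm a ^+ 2 <= t.
Proof.
move=> t0 sa sb ab abt; pose u := a + 'i%C *: b.
have su : star u = a - 'i%C *: b by rewrite starD starZ sa sb conjc_i scaleNr.
have ii : 'i%C * 'i%C = -1 :> R[i] by rewrite -expr2 sqr_i.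
have uu : star u * u = t%:C%C *: 1.
  rewrite su /u -abt mulrBl !mulrDr -!scalerAl -!scalerAr scalerA ii ab !expr2.
  by rewrite scaleN1r opprB addrACA subrr addr0.
have tu : t = cnorm u ^+ 2.
  by rewrite -cnorm_star uu cnormZ_real cnorm1 mulr1 ger0_norm.
have au : cnorm a <= cnorm u.
  have E : (2 : R)%:C%C *: a = star u + u.
    rewrite su /u addrACA addNr addr0 -[LHS]/((1 + 1)%:C%C *: a).
    by rewrite rmorphD scalerDl !scale1r.
  have := cnormD (star u) u; rewrite -E cnormZ_real cnorm_starE ger0_norm //.
  lra.
by rewrite tu ler_pXn2r ?nnegrE ?cnorm_ge0.
Qed.

End CstarAlgebraTheory.

(** Closed unital *-subalgebras. They also serve for induction: a property that defines one and
    holds on generators holds on everything generated ([gen_csub_ind], [universal_ind]). *)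
Record csub (R : realType) (A : cstarAlgType R) := Csub {
  csub_set :> A -> Prop;
  csub1 : csub_set 1;
  csubD : forall x y, csub_set x -> csub_set y -> csub_set (x + y);
  csubM : forall x y, csub_set x -> csub_set y -> csub_set (x * y);
  csubZ : forall (a : R[i]) x, csub_set x -> csub_set (a *: x);
  csub_star : forall x, csub_set x -> csub_set (star x);
  csub_closed : forall x,
    (forall e, 0 < e -> exists2 y, csub_set y & cnorm (x - y) < e) -> csub_set x
}.

Section CsubTheory.
Variables (R : realType) (A : cstarAlgType R) (S : csub A).

Lemma csub0 : S 0.
Proof. by rewrite -(scale0r (1 : A)); exact/csubZ/csub1. Qed.

Lemma csubN x : S x -> S (- x).
Proof. by move=> Sx; rewrite -scaleN1r; exact: csubZ. Qed.

Lemma csub_limit (u : nat -> A) l : (forall m, S (u m)) ->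
  (forall e, 0 < e -> exists M, forall m, (M <= m)%N -> cnorm (u m - l) < e) ->
  S l.
Proof.
move=> Su ul; apply: csub_closed => e /ul[M HM]; exists (u M) => //.
by rewrite cnormBC; exact: HM.
Qed.

Lemma csub_sum (I : Type) (r : seq I) (F : I -> A) :
  (forall i, S (F i)) -> S (\sum_(i <- r) F i).
Proof.
by move=> SF; apply: big_ind => //; [exact: csub0|exact: csubD].
Qed.

(** Made into a C*-algebra below, so that the universal property can take values in a subalgebra. *)
Definition csub_type : Type := {x : A | x \in (S : set A)}.
HB.instance Definition _ := SubType.on csub_type.
HB.instance Definition _ := [Choice of csub_type by <:].
Implicit Types (x y : csub_type).

Definition csub_val x : A := val x.
Definition csub_mk a (Sa : S a) : csub_type := Sub a (mem_set Sa : a \in (_ : set A)).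

Lemma csub_valP x : S (val x).
Proof. exact: set_mem (valP x). Qed.

Definition csub_zero := csub_mk csub0.
Definition csub_one := csub_mk (csub1 S).
Definition csub_opp x := csub_mk (csubN (csub_valP x)).
Definition csub_add x y := csub_mk (csubD (csub_valP x) (csub_valP y)).
Definition csub_mul x y := csub_mk (csubM (csub_valP x) (csub_valP y)).
Definition csub_scale (a : R[i]) x := csub_mk (csubZ a (csub_valP x)).
Definition csub_starop x := csub_mk (csub_star (csub_valP x)).

Fact csub_addA : associative csub_add.
Proof. by move=> x y z; apply: val_inj; exact: addrA. Qed.
Fact csub_addC : commutative csub_add.
Proof. by move=> x y; apply: val_inj; exact: addrC. Qed.
Fact csub_add0 : left_id csub_zero csub_add.
Proof. by move=> x; apply: val_inj; exact: add0r. Qed.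
Fact csub_addN : left_inverse csub_zero csub_opp csub_add.
Proof. by move=> x; apply: val_inj; exact: addNr. Qed.

HB.instance Definition _ := GRing.isZmodule.Build csub_type
  csub_addA csub_addC csub_add0 csub_addN.

Fact csub_scaleA a b x : csub_scale a (csub_scale b x) = csub_scale (a * b) x.
Proof. by apply: val_inj; exact: scalerA. Qed.
Fact csub_scale1 : left_id 1 csub_scale.
Proof. by move=> x; apply: val_inj; exact: scale1r. Qed.
Fact csub_scaleDr : right_distributive csub_scale +%R.
Proof. by move=> a x y; apply: val_inj; exact: scalerDr. Qed.
Fact csub_scaleDl x : {morph csub_scale^~ x : a b / a + b}.
Proof. by move=> a b; apply: val_inj; exact: scalerDl. Qed.

HB.instance Definition _ := GRing.Zmodule_isLmodule.Build R[i] csub_type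
  csub_scaleA csub_scale1 csub_scaleDr csub_scaleDl.

Fact csub_mulA : associative csub_mul.
Proof. by move=> x y z; apply: val_inj; exact: mulrA. Qed.
Fact csub_mul1 : left_id csub_one csub_mul.
Proof. by move=> x; apply: val_inj; exact: mul1r. Qed.
Fact csub_mulr1 : right_id csub_one csub_mul.
Proof. by move=> x; apply: val_inj; exact: mulr1. Qed.
Fact csub_mulDl : left_distributive csub_mul +%R.
Proof. by move=> x y z; apply: val_inj; exact: mulrDl. Qed.
Fact csub_mulDr : right_distributive csub_mul +%R.
Proof. by move=> x y z; apply: val_inj; exact: mulrDr. Qed.
Fact csub_one_neq0 : csub_one != 0.
Proof. by rewrite -(inj_eq val_inj) /= oner_eq0. Qed.

HB.instance Definition _ := GRing.Zmodule_isNzRing.Build csub_type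
  csub_mulA csub_mul1 csub_mulr1 csub_mulDl csub_mulDr csub_one_neq0.

Fact csub_scaleAl (a : R[i]) x y : a *: (x * y) = (a *: x) * y.
Proof. by apply: val_inj; exact: scalerAl. Qed.
HB.instance Definition _ :=
  GRing.Lmodule_isLalgebra.Build R[i] csub_type csub_scaleAl.
Fact csub_scaleAr (a : R[i]) x y : a *: (x * y) = x * (a *: y).
Proof. by apply: val_inj; exact: scalerAr. Qed.
HB.instance Definition _ :=
  GRing.Lalgebra_isAlgebra.Build R[i] csub_type csub_scaleAr.

Fact csub_starK : involutive csub_starop.
Proof. by move=> x; apply: val_inj; exact: starK. Qed.
Fact csub_starD : {morph csub_starop : x y / x + y}.
Proof. by move=> x y; apply: val_inj; exact: starD. Qed.
Fact csub_starM x y : csub_starop (x * y) = csub_starop y * csub_starop x.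
Proof. by apply: val_inj; exact: starM. Qed.
Fact csub_starZ (a : R[i]) x : csub_starop (a *: x) = a^* *: csub_starop x.
Proof. by apply: val_inj; exact: starZ. Qed.

HB.instance Definition _ := isStarAlgebra.Build R[i] csub_type
  csub_starK csub_starD csub_starM csub_starZ.

Definition csub_norm x : R := cnorm (val x).

Fact csub_norm_eq0 x : csub_norm x = 0 -> x = 0.
Proof. by move=> /cnorm_eq0 x0; exact: val_inj. Qed.
Fact csub_normD x y : csub_norm (x + y) <= csub_norm x + csub_norm y.
Proof. exact: cnormD. Qed.
Fact csub_normZ (a : R[i]) x :
  (csub_norm (a *: x))%:C%C = `|a| * (csub_norm x)%:C%C.
Proof. exact: cnormZ. Qed.
Fact csub_normM x y : csub_norm (x * y) <= csub_norm x * csub_norm y.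
Proof. exact: cnormM. Qed.
Fact csub_norm_star x : csub_norm (star x * x) = csub_norm x ^+ 2.
Proof. exact: cnorm_star. Qed.
Fact csub_norm_complete (u : nat -> csub_type) :
  (forall e : R, 0 < e -> exists N : nat, forall m k : nat,
      (N <= m)%N -> (N <= k)%N -> csub_norm (u m - u k) < e) ->
    exists l : csub_type, forall e : R, 0 < e -> exists N : nat,
      forall m : nat, (N <= m)%N -> csub_norm (u m - l) < e.
Proof.
move=> uC; have [l ul] := @cnorm_complete _ A (fun m => val (u m)) uC.
have Sl : S l by apply: (csub_limit _ ul) => m; exact: csub_valP.
by exists (csub_mk Sl).
Qed.

HB.instance Definition _ := isCstarAlgebra.Build R csub_type
  csub_norm_eq0 csub_normD csub_normZ csub_normM csub_norm_star
  csub_norm_complete.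

Fact csub_val_linear : linear csub_val. Proof. by []. Qed.
Fact csub_val_monoid_morphism : monoid_morphism csub_val. Proof. by []. Qed.
Fact csub_val_star : {morph csub_val : x / star x}. Proof. by []. Qed.
HB.instance Definition _ :=
  GRing.isLinear.Build R[i] csub_type A *:%R csub_val csub_val_linear.
HB.instance Definition _ :=
  GRing.isMonoidMorphism.Build csub_type A csub_val csub_val_monoid_morphism.
HB.instance Definition _ :=
  isStarMorphism.Build R[i] csub_type A csub_val csub_val_star.

End CsubTheory.

(** * Self-adjoint elements of a commutative subalgebra *)

Section SelfAdjoint.
Variables (R : realType) (A : cstarAlgType R) (S : csub A).
Hypothesis S_comm : forall x y, S x -> S y -> x * y = y * x.

Definition sa_set : set A := [set x | S x /\ star x = x].

Lemma sa_setD x y : sa_set x -> sa_set y -> sa_set (x + y).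
Proof. by move=> [Sx sx] [Sy sy]; split; [exact: csubD|rewrite starD sx sy]. Qed.

Lemma sa_setM x y : sa_set x -> sa_set y -> sa_set (x * y).
Proof.
move=> [Sx sx] [Sy sy]; split; first exact: csubM.
by rewrite starM sx sy; exact: S_comm.
Qed.

Lemma sa_setZ (r : R) x : sa_set x -> sa_set (r%:C%C *: x).
Proof.
by move=> [Sx sx]; split; [exact: csubZ|rewrite star_scale_real sx].
Qed.

Lemma sa_set1 : sa_set 1.
Proof. by split; [exact: csub1|exact: star1]. Qed.

Lemma sa_set0 : sa_set 0.
Proof. by split; [exact: csub0|exact: star0]. Qed.

Lemma sa_setN x : sa_set x -> sa_set (- x).
Proof. by move=> [Sx sx]; split; [exact: csubN|rewrite starN sx]. Qed.

End SelfAdjoint.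

(** Commutativity makes products of self-adjoint elements self-adjoint; bundling it lets [sa_type]
    carry a ring structure. *)
Record comm_csub (R : realType) (A : cstarAlgType R) := CommCsub {
  comm_csub_csub :> csub A;
  comm_csubC : forall x y, comm_csub_csub x -> comm_csub_csub y -> x * y = y * x
}.

Section SelfAdjointRing.
Variables (R : realType) (A : cstarAlgType R) (S : comm_csub A).

Definition sa_type : Type := {x : A | x \in sa_set S}.
HB.instance Definition _ := SubType.on sa_type.
HB.instance Definition _ := [Choice of sa_type by <:].
Implicit Types (x y : sa_type).

Definition sa_mk a (Sa : sa_set S a) : sa_type :=
  Sub a (mem_set Sa : a \in (_ : set A)).

Lemma sa_valP x : sa_set S (val x).
Proof. exact: set_mem (valP x). Qed.

Definition sa_zero := sa_mk (sa_set0 S).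
Definition sa_one := sa_mk (sa_set1 S).
Definition sa_opp x := sa_mk (sa_setN (sa_valP x)).
Definition sa_add x y := sa_mk (sa_setD (sa_valP x) (sa_valP y)).
Definition sa_mul x y := sa_mk (sa_setM (@comm_csubC _ _ S) (sa_valP x) (sa_valP y)).

Fact sa_addA : associative sa_add.
Proof. by move=> x y z; apply: val_inj; exact: addrA. Qed.
Fact sa_addC : commutative sa_add.
Proof. by move=> x y; apply: val_inj; exact: addrC. Qed.
Fact sa_add0 : left_id sa_zero sa_add.
Proof. by move=> x; apply: val_inj; exact: add0r. Qed.
Fact sa_addN : left_inverse sa_zero sa_opp sa_add.
Proof. by move=> x; apply: val_inj; exact: addNr. Qed.

HB.instance Definition _ := GRing.isZmodule.Build sa_type
  sa_addA sa_addC sa_add0 sa_addN.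

Fact sa_mulA : associative sa_mul.
Proof. by move=> x y z; apply: val_inj; exact: mulrA. Qed.
Fact sa_mulC : commutative sa_mul.
Proof.
move=> x y; apply: val_inj.
exact: comm_csubC (proj1 (sa_valP x)) (proj1 (sa_valP y)).
Qed.
Fact sa_mul1 : left_id sa_one sa_mul.
Proof. by move=> x; apply: val_inj; exact: mul1r. Qed.
Fact sa_mulDl : left_distributive sa_mul +%R.
Proof. by move=> x y z; apply: val_inj; exact: mulrDl. Qed.
Fact sa_one_neq0 : sa_one != 0.
Proof. by rewrite -(inj_eq val_inj) /= oner_eq0. Qed.

HB.instance Definition _ := GRing.Zmodule_isComNzRing.Build sa_type
  sa_mulA sa_mulC sa_mul1 sa_mulDl sa_one_neq0.

Definition sa_cst (r : R) : sa_type := sa_mk (sa_setZ r (sa_set1 S)).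

Fact sa_cst_zmod : zmod_morphism sa_cst.
Proof. by move=> r s; apply: val_inj; rewrite /= rmorphB scalerBl. Qed.
Fact sa_cst_monoid : monoid_morphism sa_cst.
Proof.
split=> [|r s]; apply: val_inj; first by rewrite /= rmorph1 scale1r.
by rewrite /= rmorphM -scalerAl mul1r scalerA.
Qed.
HB.instance Definition _ :=
  GRing.isZmodMorphism.Build R sa_type sa_cst sa_cst_zmod.
HB.instance Definition _ :=
  GRing.isMonoidMorphism.Build R sa_type sa_cst sa_cst_monoid.

Lemma sa_cstar_norm : real_cstar_norm sa_cst (fun x => cnorm (val x)).
Proof.
split.
- by move=> x y; exact: cnormD.
- by move=> r x; rewrite -cnormZ_real -[X in cnorm (_ *: X)]mul1r scalerAl.
- by move=> x y; exact: cnormM.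
- by move=> x /cnorm_eq0 x0; exact: val_inj.
- move=> u uC; have [l ul] := @cnorm_complete _ A (fun m => val (u m)) uC.
  have Sl : sa_set S l.
    split; first by apply: (csub_limit _ ul) => m; have [] := sa_valP (u m).
    apply/subr0_eq/cnorm_eq0/eqP; rewrite eq_le cnorm_ge0 andbT.
    apply/ler_addgt0Pr => e e0; rewrite add0r.
    have [|M /(_ M (leqnn _)) HM] := ul (e / 2); first by lra.
    have [_ su] := sa_valP (u M).
    (* The involution is isometric, so a limit of self-adjoint elements is self-adjoint. *)
    have -> : star l - l = (val (u M) - l) - star (val (u M) - l).
      by rewrite starB su opprB [RHS]addrC addrA addrNK.
    by rewrite (le_trans (cnormB _ _))// cnorm_starE; lra.
  by exists (sa_mk Sl).
- move=> a b t t0 abt; have [Sa sa] := sa_valP a; have [Sb sb] := sa_valP b.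
  apply: (cnorm_sqrD t0 sa sb); first exact: (comm_csubC Sa Sb).
  by have := congr1 val abt; rewrite !expr2.
Qed.

End SelfAdjointRing.

Section StarMorphismTheory.
Variables (K : numClosedFieldType) (A B C : starAlgType K).
Variables (f : {starmorphism A -> B}) (g : {starmorphism B -> C}).

Fact idfun_star : {morph @idfun A : x / star x}. Proof. by []. Qed.
HB.instance Definition _ := isStarMorphism.Build K A A idfun idfun_star.

Fact comp_star : {morph g \o f : x / star x}.
Proof. by move=> x; rewrite /= !starmorph. Qed.
HB.instance Definition _ := isStarMorphism.Build K A C (g \o f) comp_star.

End StarMorphismTheory.

(** * Commutants as closed subalgebras *)

Section Commutant.
Variables (R : realType) (A : cstarAlgType R) (T : A -> Prop).
Hypothesis T_star : forall x, T x -> T (star x).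

Definition commutant_set (y : A) := forall x, T x -> y * x = x * y.

Fact commutant1 : commutant_set 1.
Proof. by move=> x _; rewrite mul1r mulr1. Qed.
Fact commutantD y z : commutant_set y -> commutant_set z -> commutant_set (y + z).
Proof. by move=> Cy Cz x Tx; rewrite mulrDl mulrDr Cy ?Cz. Qed.
Fact commutantM y z : commutant_set y -> commutant_set z -> commutant_set (y * z).
Proof. by move=> Cy Cz x Tx; rewrite -mulrA Cz// !mulrA Cy. Qed.
Fact commutantZ (a : R[i]) y : commutant_set y -> commutant_set (a *: y).
Proof. by move=> Cy x Tx; rewrite -scalerAl -scalerAr Cy. Qed.
Fact commutant_star y : commutant_set y -> commutant_set (star y).
Proof.
move=> Cy x Tx; apply: (can_inj (@starK _ A)).
by rewrite !starM starK Cy//; exact: T_star.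
Qed.
Fact commutant_closed y :
  (forall e, 0 < e -> exists2 z, commutant_set z & cnorm (y - z) < e) ->
  commutant_set y.
Proof.
move=> yC x Tx; apply/subr0_eq/cnorm_eq0/eqP; rewrite eq_le cnorm_ge0 andbT.
apply/ler_addgt0Pr => e e0; rewrite add0r; have x0 := cnorm_ge0 x.
(* The commutators of [x] with [y] and with [y - z] agree, which gives the bound
   [2 * cnorm x * cnorm (y - z)]; the [+ 1] keeps the divisor positive when [x = 0]. *)
have k0 : 0 < 2 * (cnorm x + 1) by lra.
have [|z Cz yz] := yC (e / (2 * (cnorm x + 1))); first exact: divr_gt0.
have -> : y * x - x * y = (y - z) * x - x * (y - z).
  by rewrite mulrBl mulrBr Cz// opprB addrA subrK.
have := cnormB ((y - z) * x) (x * (y - z)).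
have := cnormM (y - z) x; have := cnormM x (y - z).
rewrite ltr_pdivlMr// in yz; have := cnorm_ge0 (y - z); nra.
Qed.

Definition commutant : csub A := Csub commutant1 commutantD commutantM
  commutantZ commutant_star commutant_closed.

End Commutant.

(** * A commutative subalgebra around one self-adjoint element *)

Section Bicommutant.
Variables (R : realType) (A : cstarAlgType R) (x : A).
Hypothesis sx : star x = x.

Fact singleton_star y : y = x -> star y = x. Proof. by move=> ->. Qed.

Let C1 := commutant singleton_star.
Let C2 := commutant (@csub_star _ _ C1).

(** Since [x] lies in [C1], every element of [C2] commutes with [x]; thus [C2] is inside [C1], with
    which [C2] commutes. *)
Fact bicommutantC y z : C2 y -> C2 z -> y * z = z * y.
Proof.
by move=> Cy Cz; apply: Cy => _ ->; apply: Cz => _ ->.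
Qed.
Definition bicommutant := CommCsub bicommutantC.

Lemma mem_bicommutant : bicommutant x.
Proof. by move=> y Cy; rewrite Cy. Qed.

End Bicommutant.

(* If [cnorm b < c], then [b ^+ 2 + g ^+ 2 = c ^+ 2] for some self-adjoint [g]
   commuting with [b], an equation which is preserved by [f]. *)
Theorem starmorphism_contractive (R : realType) (A B : cstarAlgType R)
  (f : {starmorphism A -> B}) x : cnorm (f x) <= cnorm x.
Proof.
have H b : star b = b -> cnorm (f b) <= cnorm b.
  move=> sb; apply/ler_addgt0Pr => e e0.
  have b0 := cnorm_ge0 b; pose t := cnorm b + e.
  have t0 : 0 <= t by rewrite /t; lra.
  pose S := bicommutant sb.
  have Sb : sa_set S b by split=> //; exact: mem_bicommutant.
  have [|g] := cst_sub_sqrt (sa_cstar_norm S) (x := sa_mk Sb ^+ 2) (t := t ^+ 2).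
    rewrite /= (le_lt_trans (cnormM _ _))// -expr2 ltr_pXn2r ?nnegrE//.
    by rewrite /t; lra.
  move=> /(congr1 val); rewrite !expr2 /= => gE.
  have [Sg sg] := sa_valP g.
  rewrite -[leRHS]/t -(@ler_pXn2r _ 2) ?nnegrE ?cnorm_ge0//.
  apply: (@cnorm_sqrD _ _ (f b) (f (val g))).
  - exact: sqr_ge0.
  - by rewrite -starmorph sb.
  - by rewrite -starmorph sg.
  - by rewrite -!rmorphM; congr (f _); apply: (comm_csubC _ Sg); case: Sb.
  - rewrite !expr2 -!rmorphM -rmorphD /= gE addrC subrK.
    by rewrite -[X in X%:C%C]expr2 linearZ rmorph1.
(* The C*-identity reduces the general case to the self-adjoint element [star x * x]. *)
rewrite -(@ler_pXn2r _ 2) ?nnegrE ?cnorm_ge0//.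
rewrite -!cnorm_star -starmorph -rmorphM; apply: H.
by rewrite starM starK.
Qed.

(** * Induction on the generators *)

Section Universal.
Variables (R : realType) (n : nat) (A : cstarAlgType R) (v : 'I_n -> A).
Hypothesis hA : is_half_liberated_sphere v.

(** Universality gives a map from [A] to [S]; followed by the inclusion it fixes the generators, so
    by uniqueness it is the identity. *)
Lemma universal_ind (S : csub A) : (forall i, S (v i)) -> forall a, S a.
Proof.
move=> Sv a; have [[v1 v2 v3] univ] := hA.
have [|phi [phiv _]] := univ (csub_type S) (fun i => csub_mk (Sv i)).
  split.
  - apply: val_inj; apply: (etrans _ v1); rewrite -[LHS]/(csub_val _) rmorph_sum /=.
    by apply: eq_bigr => i _; rewrite rmorphXn.
  - by move=> i; apply: val_inj; exact: v2.
  - by move=> i j k; apply: val_inj; exact: v3.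
have [psi [_ psiP]] := univ A v (And3 v1 v2 v3).
have E1 := psiP (@csub_val _ _ S \o phi) ltac:(by move=> i /=; rewrite phiv).
have E2 := psiP (@idfun A) ltac:(by []).
rewrite -[a]/(idfun a) E2 -E1; exact: csub_valP.
Qed.

End Universal.

(** * The C*-norm of the crossed product *)

Section ComplexTopology.
Variable R : realType.
Local Notation C := (R[i] : numClosedFieldType).
Implicit Types z w : R[i].

(** The modulus as an element of [R], since the norm of [R[i]] takes its values in [R[i]]. *)
Definition modc (z : C) : R := complex.Re `|z|.

Lemma modcE z : (modc z)%:C%C = `|z|.
Proof. by rewrite /modc normc_def. Qed.

Lemma modc_ge0 z : 0 <= modc z.
Proof. by rewrite -ler0c modcE. Qed.

Lemma modcD z w : modc (z + w) <= modc z + modc w.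
Proof. by rewrite -lecR rmorphD /= !modcE; exact: ler_normD. Qed.

Lemma modcM z w : modc (z * w) = modc z * modc w.
Proof. by apply: complexI; rewrite rmorphM /= !modcE normrM. Qed.

Lemma modc0_eq z : modc z = 0 -> z = 0.
Proof. by move=> z0; apply/normr0_eq0; rewrite -modcE z0. Qed.

Lemma modcN z : modc (- z) = modc z.
Proof. by rewrite /modc normrN. Qed.

Lemma modcJ z : modc z^* = modc z.
Proof. by rewrite /modc norm_conjC. Qed.

Lemma modc_real (r : R) : modc r%:C%C = `|r|.
Proof. by rewrite /modc normc_real. Qed.

Lemma sqr_modc z : modc z ^+ 2 = complex.Re z ^+ 2 + complex.Im z ^+ 2.
Proof. by apply: complexI; rewrite rmorphXn /= modcE -add_Re2_Im2. Qed.

Lemma normRe_le_modc z : `|complex.Re z| <= modc z.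
Proof.
rewrite -(@ler_pXn2r _ 2) ?nnegrE ?modc_ge0// sqr_modc real_normK ?num_real//.
by rewrite lerDl sqr_ge0.
Qed.

Lemma normIm_le_modc z : `|complex.Im z| <= modc z.
Proof.
rewrite -(@ler_pXn2r _ 2) ?nnegrE ?modc_ge0// sqr_modc real_normK ?num_real//.
by rewrite lerDr sqr_ge0.
Qed.

Lemma modc_le z : modc z <= `|complex.Re z| + `|complex.Im z|.
Proof.
rewrite -(@ler_pXn2r _ 2) ?nnegrE ?modc_ge0 ?addr_ge0// sqr_modc sqrrD.
rewrite !real_normK ?num_real// addrAC lerDl.
by rewrite mulrn_wge0// mulr_ge0.
Qed.

Lemma ltc_real_ex (e : C) : 0 < e -> exists2 r : R, 0 < r & e = r%:C%C.
Proof.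
case: e => a b; rewrite ltcE /= => /andP[/eqP-> a0]; by exists a.
Qed.

Lemma complex_cvgP (T : Type) (F : set_system T) (FF : Filter F)
    (f : T -> C) (l : C) :
  f @ F --> l <-> forall e : R, 0 < e -> \forall x \near F, modc (l - f x) < e.
Proof.
split=> [/cvgrPdist_lt H e e0|H].
  have := H e%:C%C; rewrite -[0]/(0%:C%C) ltcR => /(_ e0); apply: filterS => x.
  by rewrite -modcE ltcR.
apply/cvgrPdist_lt => _ /ltc_real_ex[r r0 ->].
by apply: filterS (H r r0) => x; rewrite -modcE ltcR.
Qed.

Lemma modc_continuous : continuous (modc : C -> R).
Proof.
move=> z; apply/(@cvgrPdist_lt _ _ _ _ (nbhs_filter z)) => e e0.
have := (iffLR (@complex_cvgP _ (nbhs z) (@nbhs_filter C z) id z)) (@cvg_id _ _) _ e0.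
apply: filterS => w; apply: le_lt_trans.
have := modcD (z - w) w; have := modcD (w - z) z.
rewrite !subrK -(modcN (w - z)) opprB ler_norml; lra.
Qed.

Lemma unit_square_compact :
  compact [set z : C | `|complex.Re z| <= 1 /\ `|complex.Im z| <= 1].
Proof.
have -> : [set z : C | `|complex.Re z| <= 1 /\ `|complex.Im z| <= 1] =
    (fun p : R * R => (p.1 +i* p.2)%C : C) @` (`[-1, 1]%classic `*` `[-1, 1]%classic).
  apply/seteqP; split=> [[a b] /= [a1 b1]|_ [[a b] [/= a1 b1] <-] /=].
    by exists (a, b) => //; split; rewrite /= in_itv /= -ler_norml.
  by rewrite !in_itv /= -!ler_norml in a1 b1.
apply: continuous_compact; last first.
  by apply: compact_setX; exact: segment_compact.
apply: continuous_subspaceT => -[a b]; apply/complex_cvgP => e e0.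
have e20 : 0 < e / 2 by lra.
have H1 : \forall p \near nbhs (a, b), `|a - p.1| < e / 2.
  exact: (iffLR (@cvgrPdist_lt _ R _ _ (nbhs_filter (a, b)) fst a) cvg_fst _ e20).
have H2 : \forall p \near nbhs (a, b), `|b - p.2| < e / 2.
  exact: (iffLR (@cvgrPdist_lt _ R _ _ (nbhs_filter (a, b)) snd b) cvg_snd _ e20).
near=> p; rewrite (le_lt_trans (modc_le _))//=.
suff : `|a - p.1| < e / 2 /\ `|b - p.2| < e / 2 by lra.
by split; near: p.
Unshelve. all: by end_near. Qed.

(** A closed subset of a product of compact squares: coordinates have modulus at most 1, and the
    sphere is the preimage of 1 under a continuous real function. *)
Lemma complex_sphere_compact n : compact (@complex_sphere C n).
Proof.
apply: (@subclosed_compact _ _ [set v : 'rV[C]_n | forall i,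
   [set z : C | `|complex.Re z| <= 1 /\ `|complex.Im z| <= 1] (v ord0 i)]); last first.
- move=> z zS i /=.
  have zi : modc (z 0 i) <= 1.
    rewrite -(@expr_le1 _ 2) ?modc_ge0// -lecR rmorphXn /= modcE rmorph1 -[leRHS]zS.
    by rewrite (bigD1 i)//= lerDl sumr_ge0// => j _; rewrite exprn_ge0.
  by split; rewrite (le_trans _ zi)// ?normRe_le_modc ?normIm_le_modc.
- apply: (@rV_compact C n (fun=> [set z : C |
    `|complex.Re z| <= 1 /\ `|complex.Im z| <= 1])) => i.
  exact: unit_square_compact.
have -> : @complex_sphere C n =
    (fun v : 'rV[C]_n => \sum_(i < n) modc (v 0 i) ^+ 2) @^-1` [set x : R | x = 1].
  have E (v : 'rV[C]_n) : (\sum_(i < n) modc (v 0 i) ^+ 2)%:C%C =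
      \sum_(i < n) `|v 0 i| ^+ 2.
    by rewrite rmorph_sum /=; apply: eq_bigr => i _; rewrite rmorphXn /= modcE.
  apply/seteqP; split=> v; rewrite /complex_sphere /= -E.
    by move=> H; apply: complexI.
  by move=> ->.
apply: closed_comp; last exact: closed_eq.
move=> v _; apply: (@cvg_big R _ +%R 0 xpredT _ _ (nbhs v) _ _ _
  (nbhs_filter v)) => [|i _].
  exact: add_continuous.
apply: (@continuous_comp _ _ _ (fun w : 'rV[C]_n => modc (w 0 i))
  (fun x : R => x ^+ 2)); last exact: exprn_continuous.
apply: (@continuous_comp _ _ _ (fun w : 'rV[C]_n => w 0 i) modc).
  exact: coord_continuous.
exact: modc_continuous.
Qed.

Lemma csphere_compact n : compact [set: csphere C n].
Proof.
move=> F FF _.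
have [|p [pS pF]] := @complex_sphere_compact n.+1 (set_val @ F) _.
  apply: (@filterS _ F _ [set: csphere C n]); last exact: filterT.
  by move=> z _; exact: (set_valP z).
exists (exist _ p (mem_set pS)); split => // B V FB [_ [[U oU <-] /= Up UV]].
have [|_ [[b Bb <-] Ub]] := pF (set_val @` B) U _ (open_nbhs_nbhs (conj oU Up)).
  by apply: (@filterS _ F _ B) => // b Bb; exists b.
by exists b; split => //; exact: UV.
Qed.

Lemma contfun_bounded n (f : contfun C (csphere C n)) :
  exists M : R, forall x, modc (f x) <= M.
Proof.
have [||x _ fx] := @compact_EVT_max _ R (fun x => modc (f x))
  [set: csphere C n] _ (@csphere_compact n).
- by exists point.
- apply: continuous_subspaceT => x.
  apply: (@continuous_comp _ _ _ f modc); first exact: contfun_cts.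
  exact: modc_continuous.
- by exists (modc (f x)) => y; apply: fx; rewrite inE.
Qed.

End ComplexTopology.

(** * Uniform limits of continuous functions *)

Section UniformLimits.
Variable R : realType.
Local Notation C := (R[i] : numClosedFieldType).

Lemma real_complete (a : nat -> R) :
  (forall e : R, 0 < e -> exists M, forall m k, (M <= m)%N -> (M <= k)%N ->
    `|a m - a k| < e) ->
  exists l, forall e : R, 0 < e -> exists M, forall m, (M <= m)%N -> `|a m - l| < e.
Proof.
move=> aC; have /cvg_ex[l al] : cvg (a @ \oo).
  apply: cauchy_cvg; apply: cauchy_exP => e /aC[M HM]; exists (a M).
  by exists M => // m /= Mm; exact: HM.
exists l => e e0; have [M _ HM] := (iffLR (cvgrPdist_lt _ _)) al e e0.
by exists M => m /HM; rewrite distrC.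
Qed.

Lemma contfun_complete (X : topologicalType) (u : nat -> contfun C X) :
  (forall e : R, 0 < e -> exists M, forall m k, (M <= m)%N -> (M <= k)%N ->
    forall x, modc (u m x - u k x) < e) ->
  exists l : contfun C X, forall e : R, 0 < e -> exists M, forall m, (M <= m)%N ->
    forall x, modc (u m x - l x) <= e.
Proof.
move=> uC.
have /choice[lr lrP] x : exists l : R, forall e, 0 < e ->
    exists M, forall m, (M <= m)%N -> `|complex.Re (u m x) - l| < e.
  apply: real_complete => e /uC[M HM]; exists M => m k Mm Mk.
  rewrite -raddfB; exact: le_lt_trans (normRe_le_modc _) (HM _ _ Mm Mk x).
have /choice[li liP] x : exists l : R, forall e, 0 < e ->
    exists M, forall m, (M <= m)%N -> `|complex.Im (u m x) - l| < e.
  apply: real_complete => e /uC[M HM]; exists M => m k Mm Mk.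
  rewrite -raddfB; exact: le_lt_trans (normIm_le_modc _) (HM _ _ Mm Mk x).
pose l x : C := (lr x +i* li x)%C.
have ul e : 0 < e -> exists M, forall m, (M <= m)%N -> forall x,
    modc (u m x - l x) <= e.
  move=> e0; have [M HM] := uC _ e0; exists M => m Mm x.
  apply/ler_addgt0Pr => d d0; have d20 : 0 < d / 2 by lra.
  have [M1 H1] := lrP x _ d20; have [M2 H2] := liP x _ d20.
  (* This index depends on [x] and [d] but [M] does not, so the estimate is uniform in [x]. *)
  pose k := maxn M (maxn M1 M2).
  have kM : (M <= k)%N by rewrite leq_maxl.
  have kM1 : (M1 <= k)%N by rewrite (leq_trans (leq_maxl _ M2))// leq_maxr.
  have kM2 : (M2 <= k)%N by rewrite (leq_trans (leq_maxr M1 _))// leq_maxr.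
  have -> : u m x - l x = (u m x - u k x) + (u k x - l x) by rewrite addrA subrK.
  rewrite (le_trans (modcD _ _))// lerD//; first exact/ltW/HM.
  rewrite (le_trans (modc_le _))// !raddfB /=.
  have := H1 _ kM1; have := H2 _ kM2; lra.
have lc : continuous l.
  move=> x; apply/(@complex_cvgP _ _ _ (nbhs_filter x)) => e e0.
  have e40 : 0 < e / 4 by lra.
  have [M /(_ M (leqnn _)) HM] := ul _ e40.
  have := (iffLR (@complex_cvgP _ _ _ (nbhs_filter x) _ _))
    (@contfun_cts _ _ (u M) x) _ e40.
  apply: (@filterS _ _ (nbhs_filter x)) => y ye.
  have -> : l x - l y = - (u M x - l x) + ((u M x - u M y) + (u M y - l y)).
    by rewrite addrA opprB addrCA; ring.
  have := modcD (- (u M x - l x)) ((u M x - u M y) + (u M y - l y)).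
  have := modcD (u M x - u M y) (u M y - l y).
  rewrite modcN; have := HM x; have := HM y; lra.
by exists (mkcontfun lc).
Qed.

End UniformLimits.

(** * The Euclidean norm on pairs of complex numbers *)

Section PlaneNorm.
Variable R : realType.
Local Notation C := (R[i] : numClosedFieldType).
Implicit Types a b c d : C.

Definition norm2 a b : R := Num.sqrt (modc a ^+ 2 + modc b ^+ 2).

Lemma norm2_ge0 a b : 0 <= norm2 a b.
Proof. exact: sqrtr_ge0. Qed.

Lemma sqr_norm2 a b : norm2 a b ^+ 2 = modc a ^+ 2 + modc b ^+ 2.
Proof. by rewrite sqr_sqrtr// addr_ge0// sqr_ge0. Qed.

Lemma norm2_le a b c d : modc a <= modc c -> modc b <= modc d ->
  norm2 a b <= norm2 c d.
Proof.
move=> ac bd; rewrite ler_wsqrtr// lerD// ler_pXn2r ?nnegrE ?modc_ge0//.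
Qed.

Lemma norm2Z a b c : norm2 (a * b) (a * c) = modc a * norm2 b c.
Proof.
rewrite /norm2 !modcM !exprMn -mulrDr sqrtrM ?sqr_ge0// sqrtr_sqr.
by rewrite ger0_norm ?modc_ge0.
Qed.

Lemma modc_norm2l a b : modc a <= norm2 a b.
Proof.
rewrite -(@ler_pXn2r _ 2) ?nnegrE ?modc_ge0 ?norm2_ge0// sqr_norm2.
by rewrite lerDl sqr_ge0.
Qed.

Definition dot2 a b c d : C := a * c^* + b * d^*.

Lemma modc_dot2 a b c d : modc (dot2 a b c d) <= norm2 a b * norm2 c d.
Proof.
rewrite (le_trans (modcD _ _))// !modcM !modcJ.
have p := modc_ge0 a; have q := modc_ge0 b.
have r := modc_ge0 c; have s := modc_ge0 d.
rewrite -(@ler_pXn2r _ 2) ?nnegrE ?addr_ge0 ?mulr_ge0 ?norm2_ge0//.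
rewrite exprMn !sqr_norm2 -subr_ge0.
(* Lagrange's identity for the defect in the Cauchy-Schwarz inequality. *)
rewrite [X in 0 <= X](_ : _ = (modc a * modc d - modc b * modc c) ^+ 2).
  exact: sqr_ge0.
by ring.
Qed.

Lemma dot2_self a b : modc (dot2 a b a b) = norm2 a b ^+ 2.
Proof.
rewrite /dot2 -!normCK -!modcE -!rmorphXn -rmorphD modc_real -sqr_norm2.
by rewrite ger0_norm ?sqr_ge0.
Qed.

Lemma norm2D a b c d : norm2 (a + c) (b + d) <= norm2 a b + norm2 c d.
Proof.
have E : dot2 (a + c) (b + d) (a + c) (b + d) =
    dot2 a b (a + c) (b + d) + dot2 c d (a + c) (b + d).
  by rewrite /dot2; ring.
have := norm2_ge0 (a + c) (b + d); rewrite le_eqVlt => /predU1P[<-|n0].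
  by rewrite addr_ge0 ?norm2_ge0.
rewrite -(ler_pM2r n0) -expr2 -dot2_self E mulrDl.
by rewrite (le_trans (modcD _ _))// lerD ?modc_dot2.
Qed.

End PlaneNorm.

(** * The crossed product as 2x2 matrices over the sphere *)

Section CrossedNorm.
Variables (R : realType) (n : nat).
Local Notation C := (R[i] : numClosedFieldType).
Local Notation coef1 := Defs.coef1.
Local Notation B := (crossed_product (@conj_autK C n)).
Implicit Types (x y : B) (z : csphere C n) (a b c d : C).

Lemma csphere_conjK : involutive (@csphere_conj C n).
Proof.
move=> z; apply: val_inj; apply/matrixP => i j.
by rewrite /= !mxE conjCK.
Qed.

(* [(act1 x z a b, act2 x z a b)] is the image of the vector [(a, b)] under the
   value at [z] of the representation of the crossed product on C(S) (+) C(S). *)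
Definition act1 x z a b : C := coef1 x z * a + coef_tau x z * b.
Definition act2 x z a b : C :=
  coef_tau x (csphere_conj z) * a + coef1 x (csphere_conj z) * b.
Definition act_norm x z a b : R := norm2 (act1 x z a b) (act2 x z a b).

Lemma coef1D x y z : coef1 (x + y) z = coef1 x z + coef1 y z.
Proof. by []. Qed.
Lemma coef_tauD x y z : coef_tau (x + y) z = coef_tau x z + coef_tau y z.
Proof. by []. Qed.
Lemma coef1Z a x z : coef1 (a *: x) z = a * coef1 x z.
Proof. by []. Qed.
Lemma coef_tauZ a x z : coef_tau (a *: x) z = a * coef_tau x z.
Proof. by []. Qed.
Lemma coef1M x y z : coef1 (x * y) z =
  coef1 x z * coef1 y z + coef_tau x z * coef_tau y (csphere_conj z).
Proof. by []. Qed.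
Lemma coef_tauM x y z : coef_tau (x * y) z =
  coef1 x z * coef_tau y z + coef_tau x z * coef1 y (csphere_conj z).
Proof. by []. Qed.
Lemma coef1_star x z : coef1 (star x) z = (coef1 x z)^*.
Proof. by []. Qed.
Lemma coef_tau_star x z : coef_tau (star x) z = (coef_tau x (csphere_conj z))^*.
Proof. by []. Qed.

Lemma act1M x y z a b : act1 (x * y) z a b = act1 x z (act1 y z a b) (act2 y z a b).
Proof. rewrite /act1 /act2 coef1M coef_tauM; ring. Qed.
Lemma act2M x y z a b : act2 (x * y) z a b = act2 x z (act1 y z a b) (act2 y z a b).
Proof. rewrite /act1 /act2 coef1M coef_tauM csphere_conjK; ring. Qed.

(** The matrices of [star x] are the adjoints of those of [x]; the C*-identity rests on this. *)
Lemma dot2_act x z a b c d : dot2 (act1 x z a b) (act2 x z a b) c d =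
  dot2 a b (act1 (star x) z c d) (act2 (star x) z c d).
Proof.
rewrite /dot2 /act1 /act2 !coef1_star !coef_tau_star csphere_conjK.
rewrite !rmorphD !rmorphM /= !conjCK; ring.
Qed.

(** Common bounds for the operator norms at all points; their infimum [crossed_norm] is the supremum
    of these operator norms. *)
Definition crossed_bounds x : set R :=
  [set r | 0 <= r /\ forall z a b, act_norm x z a b <= r * norm2 a b].

(** The diagonal part of each matrix has norm at most [r] and the antidiagonal part at most [s].
    With [modc_coef1_le] and [modc_coef_tau_le] this compares [crossed_norm] to the sup norms of the
    coefficients. *)
Lemma crossed_bounds_coef x r s :
  (forall z, modc (coef1 x z) <= r) -> (forall z, modc (coef_tau x z) <= s) ->
  crossed_bounds x (r + s).
Proof.
move=> xr xs.
have r0 : 0 <= r by exact: le_trans (modc_ge0 _) (xr point).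
have s0 : 0 <= s by exact: le_trans (modc_ge0 _) (xs point).
split=> [|z a b]; first exact: addr_ge0.
have act2C : act2 x z a b =
    coef1 x (csphere_conj z) * b + coef_tau x (csphere_conj z) * a.
  exact: addrC.
rewrite /act_norm act2C /act1 mulrDl.
rewrite (le_trans (norm2D _ _ _ _))// lerD//.
  rewrite -{1}(ger0_norm r0) -modc_real -norm2Z norm2_le// !modcM modc_real ger0_norm//;
  by rewrite ler_wpM2r ?modc_ge0.
rewrite -{1}(ger0_norm s0) -modc_real -norm2Z.
have -> : norm2 (s%:C%C * a) (s%:C%C * b) = norm2 (s%:C%C * b) (s%:C%C * a).
  by rewrite /norm2 addrC.
rewrite norm2_le// !modcM modc_real ger0_norm//;
by rewrite ler_wpM2r ?modc_ge0.
Qed.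

Lemma crossed_bounds_nonempty x : crossed_bounds x !=set0.
Proof.
have [r xr] := contfun_bounded (coef1 x).
have [s xs] := contfun_bounded (coef_tau x).
by exists (r + s); exact: crossed_bounds_coef.
Qed.

Definition crossed_norm x : R := inf (crossed_bounds x).

Lemma crossed_norm_ge0 x : 0 <= crossed_norm x.
Proof.
by apply: lb_le_inf; [exact: crossed_bounds_nonempty|move=> r []].
Qed.

Lemma crossed_norm_le x r : crossed_bounds x r -> crossed_norm x <= r.
Proof. by move=> xr; apply: ge_inf => //; exists 0 => s []. Qed.

Lemma act_norm_le x z a b : act_norm x z a b <= crossed_norm x * norm2 a b.
Proof.
have := norm2_ge0 a b; rewrite le_eqVlt => /predU1P[ab0|ab0].
  have [r [_ /(_ z a b)]] := crossed_bounds_nonempty x.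
  by rewrite -ab0 !mulr0.
rewrite -ler_pdivrMr//; apply: lb_le_inf; first exact: crossed_bounds_nonempty.
by move=> r [_ /(_ z a b)]; rewrite ler_pdivrMr.
Qed.

Lemma norm2_10 : norm2 (1 : C) 0 = 1.
Proof. by rewrite /norm2 !modc_real normr1 normr0 expr1n expr0n addr0 sqrtr1. Qed.

Lemma act_norm10 x z :
  act_norm x z 1 0 = norm2 (coef1 x z) (coef_tau x (csphere_conj z)).
Proof. by rewrite /act_norm /act1 /act2 !mulr1 !mulr0 !addr0. Qed.

Lemma modc_coef1_le x z : modc (coef1 x z) <= crossed_norm x.
Proof.
have := act_norm_le x z 1 0; rewrite norm2_10 mulr1 act_norm10.
exact/le_trans/modc_norm2l.
Qed.

Lemma modc_coef_tau_le x z : modc (coef_tau x z) <= crossed_norm x.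
Proof.
(* The lower entry of the first column is [coef_tau] at the conjugate point, so evaluation takes
   place at the conjugate of [z]. *)
have := act_norm_le x (csphere_conj z) 1 0; rewrite norm2_10 mulr1 act_norm10.
rewrite csphere_conjK /norm2 addrC; exact/le_trans/modc_norm2l.
Qed.

Lemma crossed_norm_eq0 x : crossed_norm x = 0 -> x = 0.
Proof.
move=> x0; apply: crossedP; apply: contfunP => z; apply: modc0_eq; apply/eqP;
  rewrite eq_le modc_ge0 andbT -x0.
  exact: modc_coef1_le.
exact: modc_coef_tau_le.
Qed.

Lemma crossed_normD x y : crossed_norm (x + y) <= crossed_norm x + crossed_norm y.
Proof.
apply: crossed_norm_le; split=> [|z a b].
  by rewrite addr_ge0 ?crossed_norm_ge0.
have -> : act_norm (x + y) z a b =
    norm2 (act1 x z a b + act1 y z a b) (act2 x z a b + act2 y z a b).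
  by congr norm2; rewrite /act1 /act2 coef1D coef_tauD; ring.
rewrite mulrDl (le_trans (norm2D _ _ _ _))//.
by rewrite lerD//; exact: act_norm_le.
Qed.

Lemma crossed_normZ_le c x : crossed_norm (c *: x) <= modc c * crossed_norm x.
Proof.
apply: crossed_norm_le; split=> [|z a b].
  by rewrite mulr_ge0 ?crossed_norm_ge0 ?modc_ge0.
have -> : act_norm (c *: x) z a b = norm2 (c * act1 x z a b) (c * act2 x z a b).
  by congr norm2; rewrite /act1 /act2 coef1Z coef_tauZ; ring.
by rewrite norm2Z -mulrA ler_wpM2l ?modc_ge0//; exact: act_norm_le.
Qed.

Lemma crossed_normZ c x : (crossed_norm (c *: x))%:C%C = `|c| * (crossed_norm x)%:C%C.
Proof.
rewrite -modcE -rmorphM; congr (_%:C%C); apply/eqP; rewrite eq_le crossed_normZ_le /=.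
have [->|c0] := eqVneq c 0.
  by rewrite modc_real normr0 mul0r crossed_norm_ge0.
have := crossed_normZ_le c^-1 (c *: x); rewrite scalerA mulVf// scale1r => H.
rewrite (le_trans (ler_wpM2l (modc_ge0 c) H))// mulrA -modcM mulfV//.
by rewrite modc_real normr1 mul1r.
Qed.

Lemma crossed_normM x y : crossed_norm (x * y) <= crossed_norm x * crossed_norm y.
Proof.
apply: crossed_norm_le; split=> [|z a b].
  by rewrite mulr_ge0 ?crossed_norm_ge0.
rewrite /act_norm act1M act2M (le_trans (act_norm_le _ _ _ _))// -mulrA.
by rewrite ler_wpM2l ?crossed_norm_ge0//; exact: act_norm_le.
Qed.

(** Cauchy-Schwarz for the inner product of [u = (a, b)] with [star x * x] applied to [u], which is
    the squared norm of [x] applied to [u]. *)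
Lemma sqr_act_norm x z a b :
  act_norm x z a b ^+ 2 <= act_norm (star x * x) z a b * norm2 a b.
Proof.
rewrite -dot2_self dot2_act -act1M -act2M /dot2.
have -> : a * (act1 (star x * x) z a b)^* + b * (act2 (star x * x) z a b)^* =
  dot2 a b (act1 (star x * x) z a b) (act2 (star x * x) z a b) by [].
by rewrite mulrC modc_dot2.
Qed.

Lemma crossed_norm_sqr_le x : crossed_norm x ^+ 2 <= crossed_norm (star x * x).
Proof.
have s0 := crossed_norm_ge0 (star x * x).
rewrite -(sqr_sqrtr s0) ler_pXn2r ?nnegrE ?crossed_norm_ge0 ?sqrtr_ge0//.
apply: crossed_norm_le; split=> [|z a b]; first exact: sqrtr_ge0.
rewrite -(@ler_pXn2r _ 2) ?nnegrE ?mulr_ge0 ?sqrtr_ge0 ?norm2_ge0//.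
rewrite exprMn [X in _ <= X * _]sqr_sqrtr// (le_trans (sqr_act_norm _ _ _ _))//.
by rewrite expr2 mulrA ler_wpM2r ?norm2_ge0//; exact: act_norm_le.
Qed.

Lemma crossed_norm_star x : crossed_norm (star x * x) = crossed_norm x ^+ 2.
Proof.
have le_star y : crossed_norm y <= crossed_norm (star y).
  have := crossed_norm_ge0 y; rewrite le_eqVlt => /predU1P[<-|y0].
    exact: crossed_norm_ge0.
  rewrite -(ler_pM2r y0) -expr2 (le_trans (crossed_norm_sqr_le _))//.
  exact: crossed_normM.
apply/eqP; rewrite eq_le crossed_norm_sqr_le andbT.
rewrite (le_trans (crossed_normM _ _))// expr2 ler_wpM2r ?crossed_norm_ge0//.
by rewrite -{2}[x]starK.
Qed.

Lemma crossed_norm_complete (u : nat -> B) :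
  (forall e : R, 0 < e -> exists N : nat, forall m k : nat,
    (N <= m)%N -> (N <= k)%N -> crossed_norm (u m - u k) < e) ->
  exists l : B, forall e : R, 0 < e -> exists N : nat, forall m : nat,
    (N <= m)%N -> crossed_norm (u m - l) < e.
Proof.
move=> uC.
have [e /uC[M HM]|l1 l1P] := @contfun_complete R _ (fun m => coef1 (u m)).
  exists M => m k Mm Mk z.
  exact: le_lt_trans (modc_coef1_le (u m - u k) z) (HM _ _ Mm Mk).
have [e /uC[M HM]|l2 l2P] := @contfun_complete R _ (fun m => coef_tau (u m)).
  exists M => m k Mm Mk z.
  exact: le_lt_trans (modc_coef_tau_le (u m - u k) z) (HM _ _ Mm Mk).
exists (Crossed _ l1 l2) => e e0.
have e30 : 0 < e / 3 by lra.
have [M1 H1] := l1P _ e30; have [M2 H2] := l2P _ e30.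
exists (maxn M1 M2) => m; rewrite geq_max => /andP[/H1 H1m /H2 H2m].
have : crossed_norm (u m - Crossed _ l1 l2) <= e / 3 + e / 3.
  exact/crossed_norm_le/crossed_bounds_coef.
by lra.
Qed.

HB.instance Definition _ := isCstarAlgebra.Build R B
  crossed_norm_eq0 crossed_normD crossed_normZ crossed_normM crossed_norm_star
  crossed_norm_complete.

End CrossedNorm.

(** * The grading of the half-liberated sphere *)

(** Take a column of [p] through a nonzero diagonal entry, divided by the root of that entry;
    [p i k * p k j = p k k * p i j] gives the factorization. *)
Lemma rank_one (K : numClosedFieldType) (m : nat) (p : 'I_m -> 'I_m -> K) :
  \sum_i p i i = 1 -> (forall i j, (p i j)^* = p j i) ->
  (forall i j k l, p i j * p k l = p k j * p i l) ->
  exists2 z : 'I_m -> K, \sum_i `|z i| ^+ 2 = 1 &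
    forall i j, p i j = z i * (z j)^*.
Proof.
move=> tr1 pJ pM.
(* Trace 1 gives [p k k = \sum_j p k k * p j j = \sum_j p j k * p k j], a sum of squared moduli. *)
have p_ge0 k : 0 <= p k k.
  rewrite -[p k k]mulr1 -tr1 mulr_sumr sumr_ge0// => j _.
  by rewrite pM -pJ mulrC mul_conjC_ge0.
have [k pk0] : exists k, p k k != 0.
  apply: contrapT => npk; have := tr1; rewrite big1 => [/eqP|k _].
    by rewrite eq_sym oner_eq0.
  by apply/eqP/negP => /negP pk; apply: npk; exists k.
pose s := sqrtC (p k k).
have s_real : s^* = s.
  by apply/CrealP/ger0_real; rewrite sqrtC_ge0.
have ss : s * s = p k k by rewrite -expr2 sqrtCK.
pose z i := p i k / s.
have pz i j : p i j = z i * (z j)^*.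
  rewrite /z rmorphM fmorphV /= s_real pJ mulrACA pM -invfM ss mulrAC mulfV//.
  by rewrite mul1r.
exists z => //; rewrite -[RHS]tr1; apply: eq_bigr => i _.
by rewrite pz normCK.
Qed.

(** * Generated closed subalgebras *)

Section GeneratedCsub.
Variables (R : realType) (A : cstarAlgType R).

(** Provides the closure axiom for subsets defined by Lipschitz conditions, such as evenness of
    [v i * x * v j]. *)
Lemma csub_adherent_lipschitz (P : A -> Prop) (A' : cstarAlgType R)
    (S : csub A') (f : A -> A') (k : R) x :
  (forall y z, cnorm (f y - f z) <= k * cnorm (y - z)) ->
  (forall y, P y -> S (f y)) ->
  (forall e, 0 < e -> exists2 y, P y & cnorm (x - y) < e) -> S (f x).
Proof.
move=> fk PS xP; apply: csub_closed => e e0.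
have k0 : 0 < `|k| + 1 by rewrite ltr_wpDl.
have [|y Py xy] := xP (e / (`|k| + 1)); first exact: divr_gt0.
exists (f y); first exact: PS.
rewrite ltr_pdivlMr// in xy; apply: le_lt_trans xy.
rewrite (le_trans (fk _ _))// mulrC ler_wpM2l ?cnorm_ge0//.
by have := ler_norm k; lra.
Qed.

Variable T : A -> Prop.

Definition gen_set x := forall S : csub A, (forall t, T t -> S t) -> S x.

Definition gen_csub : csub A.
Proof.
apply: (@Csub _ _ gen_set).
- by move=> S _; exact: csub1.
- by move=> x y Tx Ty S TS; apply: csubD; [exact: Tx|exact: Ty].
- by move=> x y Tx Ty S TS; apply: csubM; [exact: Tx|exact: Ty].
- by move=> a x Tx S TS; apply/csubZ/Tx.
- by move=> x Tx S TS; apply/csub_star/Tx.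
- move=> x xP S TS; apply: csub_closed => e /xP[y Ty xy].
  by exists y => //; exact: Ty.
Defined.

Lemma gen_csub_sub x : T x -> gen_csub x.
Proof. by move=> Tx S; apply. Qed.

Lemma gen_csub_ind (S : csub A) : (forall t, T t -> S t) ->
  forall x, gen_csub x -> S x.
Proof. by move=> TS x; apply. Qed.

End GeneratedCsub.

(** * Even and odd elements *)

Section HalfLiberated.
Variables (R : realType) (n : nat) (A : cstarAlgType R) (v : 'I_n -> A).
Hypothesis hv : half_liberated_relations v.

Let v_sqr : \sum_i v i * v i = 1.
Proof. by have [<- _ _] := hv; apply: eq_bigr => i _; rewrite expr2. Qed.
Let v_star i : star (v i) = v i. Proof. by have [_ -> _] := hv. Qed.
Let v_half i j k : v i * v j * v k = v k * v j * v i.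
Proof. by have [_ _ ->] := hv. Qed.

Definition quadratic (x : A) := exists i j, x = v i * v j.

Lemma quadratic_star x : quadratic x -> quadratic (star x).
Proof. by move=> [i [j ->]]; exists j, i; rewrite starM !v_star. Qed.

Definition even_csub := gen_csub quadratic.

Lemma even_quadratic i j : even_csub (v i * v j).
Proof. by apply: gen_csub_sub; exists i, j. Qed.

(** Quadratic words commute: [v i * v j * v k * v l = v k * v j * v i * v l = v k * v l * v i * v
    j]. Two inductions through commutants extend this, one for each factor. *)
Lemma even_comm x y : even_csub x -> even_csub y -> x * y = y * x.
Proof.
have E1 z : even_csub z -> commutant quadratic_star z.
  apply: gen_csub_ind => _ [i [j ->]] _ [k [l ->]].
  by rewrite !mulrA v_half -!(mulrA (v k)) v_half.
move=> Ex Ey; have E2 z : even_csub z -> commutant (@csub_star _ _ even_csub) z.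
  apply: gen_csub_ind => t Tt w Ew; symmetry; exact: E1.
exact: E2.
Qed.

Definition even_elt : comm_csub A := CommCsub even_comm.

(** Hands one generator to each factor, which turns products of odd elements into sums of products
    of even ones. *)
Lemma insert_unit x y : x * y = \sum_k (x * v k) * (v k * y).
Proof.
rewrite -[x in LHS]mulr1 -v_sqr mulr_sumr mulr_suml.
by apply: eq_bigr => k _; rewrite !mulrA.
Qed.

(** The even elements with all sandwiches even form a closed *-subalgebra; for products, [v i * (y *
    z) * v j = \sum_k (v i * y * v k) * (v k * z * v j)]. *)
Lemma even_sandwich x i j : even_elt x -> even_elt (v i * x * v j).
Proof.
pose P x := even_elt x /\ forall i j, even_elt (v i * x * v j).
suff [S SP] : exists S : csub A, S = P :> (A -> Prop).
  have : forall x, even_elt x -> S x.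
    apply: gen_csub_ind => t [k [l ->]]; rewrite SP; split=> [|i' j'].
      exact: even_quadratic.
    by rewrite mulrA -[X in even_elt X]mulrA; apply: csubM; exact: even_quadratic.
  by rewrite SP => H /H[].
unshelve eexists (@Csub _ _ P _ _ _ _ _ _); last by [].
- by split=> [|i' j']; [exact: csub1|rewrite mulr1; exact: even_quadratic].
- move=> y z [Ey Py] [Ez Pz]; split=> [|i' j']; first exact: csubD.
  by rewrite mulrDr mulrDl; exact: csubD.
- move=> y z [Ey Py] [Ez Pz]; split=> [|i' j']; first exact: csubM.
  rewrite mulrA -mulrA insert_unit; apply: csub_sum => k; apply: csubM => //.
  by rewrite mulrA.
- move=> a y [Ey Py]; split=> [|i' j']; first exact: csubZ.
  by rewrite -scalerAr -scalerAl; exact: csubZ.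
- move=> y [Ey Py]; split=> [|i' j']; first exact: csub_star.
  by rewrite -(v_star i') -(v_star j') -!starM; rewrite mulrA; exact: csub_star.
- move=> y yP; split=> [|i' j'].
    by apply: csub_closed => e /yP[z [Ez _] yz]; exists z.
  apply: (csub_adherent_lipschitz (P := P) (f := fun y => v i' * y * v j')
    (k := cnorm (v i') * cnorm (v j'))) => // [w z|w []//].
  rewrite -mulrBl -mulrBr (le_trans (cnormM _ _))// mulrAC ler_wpM2r ?cnorm_ge0//.
  exact: cnormM.
Qed.

(** Multiplication by generators on either side tests oddness, a closed linear condition stated
    through the even part alone. *)
Definition odd_elt x := forall i, even_elt (v i * x) /\ even_elt (x * v i).

Lemma odd_gen i : odd_elt (v i).
Proof. by move=> j; split; exact: even_quadratic. Qed.

Lemma oddD x y : odd_elt x -> odd_elt y -> odd_elt (x + y).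
Proof.
move=> Ox Oy i; have [x1 x2] := Ox i; have [y1 y2] := Oy i.
by rewrite mulrDr mulrDl; split; exact: csubD.
Qed.

Lemma oddZ (a : R[i]) x : odd_elt x -> odd_elt (a *: x).
Proof.
move=> Ox i; have [x1 x2] := Ox i.
by rewrite -scalerAr -scalerAl; split; exact: csubZ.
Qed.

Lemma odd_star x : odd_elt x -> odd_elt (star x).
Proof.
move=> Ox i; have [x1 x2] := Ox i.
by split; rewrite -(v_star i) -starM; exact: csub_star.
Qed.

Lemma oddMM x y : odd_elt x -> odd_elt y -> even_elt (x * y).
Proof.
move=> Ox Oy; rewrite insert_unit; apply: csub_sum => k.
by apply: csubM; [case: (Ox k)|case: (Oy k)].
Qed.

Lemma even_oddM x y : even_elt x -> odd_elt y -> odd_elt (x * y).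
Proof.
move=> Ex Oy i; split; last by rewrite -mulrA; apply: csubM; last by case: (Oy i).
rewrite mulrA insert_unit; apply: csub_sum => k.
by apply: csubM; [exact: even_sandwich|case: (Oy k)].
Qed.

Lemma odd_evenM x y : odd_elt x -> even_elt y -> odd_elt (x * y).
Proof.
move=> Ox Ey i; split; first by rewrite mulrA; apply: csubM; first by case: (Ox i).
rewrite -mulrA insert_unit; apply: csub_sum => k.
by apply: csubM; [case: (Ox k)|rewrite mulrA; exact: even_sandwich].
Qed.

End HalfLiberated.

(** * Decomposition into even and odd parts *)

Section Grading.
Variables (R : realType) (n : nat) (A : cstarAlgType R) (v : 'I_n -> A).
Hypothesis hA : is_half_liberated_sphere v.
Let hv : half_liberated_relations v := proj1 hA.

(* The decomposition is recovered continuously from the automorphism [s] sending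
   [v i] to [- v i]; thus the elements which have one form a closed set. *)
Lemma even_odd_decomposition a :
  exists e o, [/\ even_elt hv e, odd_elt hv o & a = e + o].
Proof.
have [s sv] : exists s : {starmorphism A -> A}, forall i, s (v i) = - v i.
  have [v1 v2 v3] := hv.
  have [|s [sv _]] := (proj2 hA) A (fun i => - v i); last by exists s.
  split=> [|i|i j k].
  - by rewrite -v1; apply: eq_bigr => i _; rewrite sqrrN.
  - by rewrite starN v2.
  - by rewrite !mulrNN !mulrN v3.
pose P a := exists e o, [/\ even_elt hv e, odd_elt hv o, a = e + o & s a = e - o].
suff [S SP] : exists S : csub A, S = P :> (A -> Prop).
  have : S a.
    apply: (universal_ind hA) => i; rewrite SP; exists 0, (v i).
    by split; [exact: csub0|exact: odd_gen|rewrite add0r|rewrite sv sub0r].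
  by rewrite SP => -[e [ o [Ee Oo ao _]]]; exists e, o.
pose h : R[i] := (2^-1 : R)%:C%C.
have hh x : h *: x + h *: x = x :> A.
  by rewrite -scalerDl -rmorphD /= (_ : 2^-1 + 2^-1 = 1) ?scale1r//; lra.
unshelve eexists (@Csub _ _ P _ _ _ _ _ _); last by [].
- exists 1, 0; rewrite !addr0 subr0 rmorph1; split => //; first exact: csub1.
  by move=> i; rewrite mulr0 mul0r; split; exact: csub0.
- move=> _ _ [e [ o [Ee Oo -> so]]] [e' [ o' [Ee' Oo' -> so']]].
  exists (e + e'), (o + o'); split; [exact: csubD|exact: oddD| |].
    by rewrite addrACA.
  by rewrite rmorphD /= so so' opprD addrACA.
- move=> _ _ [e [ o [Ee Oo -> so]]] [e' [ o' [Ee' Oo' -> so']]].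
  exists (e * e' + o * o'), (e * o' + o * e'); split.
  + by apply: csubD; [exact: csubM|exact: oddMM].
  + by apply: oddD; [exact: even_oddM|exact: odd_evenM].
  + by rewrite mulrDl !mulrDr [ o * e' + _]addrC addrACA.
  + by rewrite rmorphM /= so so' mulrBl !mulrBr opprB opprD addrACA.
- move=> a' _ [e [ o [Ee Oo -> so]]]; exists (a' *: e), (a' *: o); split.
  + exact: csubZ.
  + exact: oddZ.
  + by rewrite scalerDr.
  + by rewrite linearZ /= so scalerBr.
- move=> _ [e [ o [Ee Oo -> so]]]; exists (star e), (star o); split.
  + exact: csub_star.
  + exact: odd_star.
  + by rewrite starD.
  + by rewrite starmorph so starB.
- move=> x xP.
  (* Averaging against [s] recovers the two parts. Both maps are 1-Lipschitz because [s] is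
     contractive, so the parts of a limit are limits of parts. *)
  pose fe y := h *: (y + s y); pose fo y := h *: (y - s y).
  have nh y : cnorm (h *: y) = 2^-1 * cnorm y.
    by rewrite cnormZ_real ger0_norm// invr_ge0.
  have fe_lip y z : cnorm (fe y - fe z) <= cnorm (y - z).
    have -> : fe y - fe z = h *: ((y - z) + s (y - z)).
      by rewrite -scalerBr rmorphB /= opprD addrACA.
    rewrite nh; have := cnormD (y - z) (s (y - z)).
    have := starmorphism_contractive s (y - z); lra.
  have fo_lip y z : cnorm (fo y - fo z) <= cnorm (y - z).
    have -> : fo y - fo z = h *: ((y - z) - s (y - z)).
      by rewrite -scalerBr rmorphB /= !opprD !opprK addrACA [- s y + _]addrC addrC.
    rewrite nh; have := cnormB (y - z) (s (y - z)).
    have := starmorphism_contractive s (y - z); lra.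
  have feE y e o : y = e + o -> s y = e - o -> fe y = e.
    by move=> -> E; rewrite /fe E addrACA subrr addr0 scalerDr hh.
  have foE y e o : y = e + o -> s y = e - o -> fo y = o.
    by move=> -> E; rewrite /fo E opprD opprK addrACA subrr add0r scalerDr hh.
  exists (fe x), (fo x); split.
  + apply: (csub_adherent_lipschitz (P := P) (k := 1)) xP => [y z|y].
      by rewrite mul1r.
    by move=> [e [ o [Ee Oo yeo so]]]; rewrite (feE _ _ _ yeo so).
  + move=> i; split.
    * apply: (csub_adherent_lipschitz (P := P)
        (f := fun y => v i * fo y) (k := cnorm (v i))) xP => [y z|y].
        by rewrite -mulrBr (le_trans (cnormM _ _))// ler_wpM2l ?cnorm_ge0.
      by move=> [e [ o [Ee Oo yeo so]]]; rewrite (foE _ _ _ yeo so); case: (Oo i).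
    * apply: (csub_adherent_lipschitz (P := P)
        (f := fun y => fo y * v i) (k := cnorm (v i))) xP => [y z|y].
        by rewrite -mulrBl (le_trans (cnormM _ _))// mulrC ler_wpM2l ?cnorm_ge0.
      by move=> [e [ o [Ee Oo yeo so]]]; rewrite (foE _ _ _ yeo so); case: (Oo i).
  + by rewrite -scalerDr addrACA subrr addr0 scalerDr hh.
  + by rewrite -scalerBr opprD opprK addrACA subrr add0r scalerDr hh.
Qed.

End Grading.

(** * Injectivity *)

Section ComplexCharacter.
Variables (R : realType) (A : cstarAlgType R) (S : comm_csub A).
Local Notation C := (R[i] : numClosedFieldType).
Variable chi : sa_type S -> R.
Hypotheses (chiD : {morph chi : x y / x + y}) (chiM : {morph chi : x y / x * y}).
Hypothesis chi_cst : forall r, chi (sa_cst S r) = r.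
Hypothesis chi_norm : forall x, `|chi x| <= cnorm (val x).
Implicit Types (p q : sa_type S) (x y : A) (w : R[i]).

Let chi0 : chi 0 = 0.
Proof. by apply: (addrI (chi 0)); rewrite -chiD !addr0. Qed.

Let chiN p : chi (- p) = - chi p.
Proof. by apply: (addrI (chi p)); rewrite -chiD !subrr. Qed.

(* The complex-linear extension of [chi] to [S], presented as a relation. *)
Definition cvalue x w := exists p q,
  x = val p + 'i%C *: val q /\ w = (chi p +i* chi q)%C.

Let sqr_i_scale x : 'i%C *: ('i%C *: x) = - x.
Proof. by rewrite scalerA -expr2 sqr_i scaleN1r. Qed.

Let star_decomposition p q :
  star (val p + 'i%C *: val q) = val p - 'i%C *: val q.
Proof.
rewrite starD starZ conjc_i scaleNr.
by have [_ ->] := sa_valP p; have [_ ->] := sa_valP q.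
Qed.

Let half : R[i] := (2^-1 : R)%:C%C.

Let halfD x : half *: (x + x) = x.
Proof.
by rewrite scalerDr -scalerDl -rmorphD /= (_ : 2^-1 + 2^-1 = 1) ?scale1r//; lra.
Qed.

Let re_decomposition p q x : x = val p + 'i%C *: val q ->
  val p = half *: (x + star x) /\ val q = half *: ('i%C *: (star x - x)).
Proof.
move=> ->; rewrite star_decomposition; split.
  by rewrite addrACA subrr addr0 halfD.
rewrite opprD addrACA subrr add0r -opprD scalerN -scalerDr sqr_i_scale.
by rewrite opprK halfD.
Qed.

Lemma cvalue_exists x : S x -> exists w, cvalue x w.
Proof.
move=> Sx; have Ssx := csub_star Sx.
have Sp : sa_set S (half *: (x + star x)).
  split; first by apply: csubZ; exact: csubD.
  by rewrite star_scale_real starD starK addrC.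
have Sq : sa_set S (half *: ('i%C *: (star x - x))).
  split; first by apply/csubZ/csubZ/csubD => //; exact: csubN.
  by rewrite star_scale_real starZ conjc_i starB starK scaleNr -scalerN opprB.
exists (chi (sa_mk Sp) +i* chi (sa_mk Sq))%C, (sa_mk Sp), (sa_mk Sq); split=> //=.
rewrite scalerA mulrC -scalerA -scalerDr sqr_i_scale opprB.
by rewrite addrACA subrr addr0 halfD.
Qed.

Lemma cvalue_unique x w w' : cvalue x w -> cvalue x w' -> w = w'.
Proof.
move=> [p [q [/re_decomposition[Ep Eq] ->]]] [p' [q' [/re_decomposition[Ep' Eq'] ->]]].
by congr (chi _ +i* chi _)%C; apply: val_inj; rewrite ?Ep' ?Eq' ?Ep ?Eq.
Qed.

Lemma cvalueD x y w w' : cvalue x w -> cvalue y w' -> cvalue (x + y) (w + w').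
Proof.
move=> [p [q [-> ->]]] [p' [q' [-> ->]]]; exists (p + p'), (q + q'); split.
  by rewrite /= scalerDr addrACA.
by rewrite !chiD.
Qed.

Lemma cvalueN x w : cvalue x w -> cvalue (- x) (- w).
Proof.
move=> [p [q [-> ->]]]; exists (- p), (- q); split.
  by rewrite /= scalerN opprD.
by rewrite !chiN.
Qed.

Lemma cvalueM x y w w' : cvalue x w -> cvalue y w' -> cvalue (x * y) (w * w').
Proof.
move=> [p [q [-> ->]]] [p' [q' [-> ->]]].
exists (p * p' - q * q'), (p * q' + q * p'); split.
  rewrite /= mulrDl !mulrDr -!scalerAl -!scalerAr sqr_i_scale scalerDr.
  by rewrite [_ + - (val q * _)]addrC addrACA.
by rewrite !chiD chiN !chiM.
Qed.

Lemma cvalue_scalar (a : C) : cvalue (a *: 1) a.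
Proof.
case: a => a b; exists (sa_cst S a), (sa_cst S b); split; last by rewrite !chi_cst.
rewrite /= scalerA -scalerDl; congr (_ *: _).
by rewrite [LHS]complexE.
Qed.

Lemma cvalueZ (a : C) x w : cvalue x w -> cvalue (a *: x) (a * w).
Proof.
by move=> xw; have := cvalueM (cvalue_scalar a) xw; rewrite -scalerAl mul1r.
Qed.

Lemma cvalue1 : cvalue 1 1.
Proof. by have := cvalue_scalar 1; rewrite scale1r. Qed.

Lemma cvalue_star x w : cvalue x w -> cvalue (star x) w^*.
Proof.
move=> [p [q [-> ->]]]; exists p, (- q).
by rewrite star_decomposition /= scalerN chiN.
Qed.

Lemma cvalue_sa p : cvalue (val p) (chi p)%:C%C.
Proof. by exists p, 0; rewrite /= scaler0 addr0 chi0. Qed.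

(** Real and imaginary parts are bounded separately; the resulting factor 2 is harmless in the limit
    argument of [even_kernel]. *)
Lemma cvalue_norm x w : cvalue x w -> modc w <= cnorm x + cnorm x.
Proof.
move=> [p [q [/re_decomposition[Ep Eq] ->]]].
have hn y : cnorm (half *: y) = 2^-1 * cnorm y.
  by rewrite cnormZ_real ger0_norm ?invr_ge0.
have in1 y : cnorm ('i%C *: y) = cnorm y.
  by apply: complexI; rewrite cnormZ normc_i mul1r.
have := modc_le (chi p +i* chi q)%C; have := chi_norm p; have := chi_norm q.
rewrite Ep Eq !hn in1 /=.
have := cnormD x (star x); have := cnormB (star x) x; rewrite cnorm_starE; lra.
Qed.

End ComplexCharacter.

(** * The kernel of the representation *)

Section Injectivity.
Variables (R : realType) (n : nat) (A : cstarAlgType R) (v : 'I_n.+1 -> A).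
Hypothesis hv : half_liberated_relations v.
Local Notation C := (R[i] : numClosedFieldType).
Local Notation coef1 := Defs.coef1.
Local Notation B := (crossed_product (@conj_autK C n)).
Variable pi : {starmorphism A -> B}.
Hypothesis pi_v : forall i, pi (v i) = tensor_tau (@conj_autK C n) (ccoord C i).

Lemma pi_quadratic i j :
  pi (v i * v j) = tensor1 (@conj_autK C n) (ccoord C i * star (ccoord C j)).
Proof. by rewrite rmorphM /= !pi_v tensor_tauM conj_aut_ccoord. Qed.

(** Elements whose image has no [tau] component form a subalgebra containing the quadratic words; it
    is closed because [pi] is contractive. *)
Lemma coef_tau_even x : even_elt hv x -> coef_tau (pi x) = 0.
Proof.
pose P x := coef_tau (pi x) = 0.
suff [S SP] : exists S : csub A, S = P :> (A -> Prop).
  move=> Ex; rewrite -/(P x) -SP; apply: gen_csub_ind Ex => _ [i [j ->]].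
  by rewrite SP /P pi_quadratic.
unshelve eexists (@Csub _ _ P _ _ _ _ _ _); last by [].
- by rewrite /P rmorph1.
- by move=> y z Py Pz; rewrite /P rmorphD /= Py Pz addr0.
- by move=> y z Py Pz; rewrite /P rmorphM /= Py Pz mulr0 mul0r addr0.
- by move=> a y Py; rewrite /P linearZ /= Py scaler0.
- by move=> y Py; rewrite /P starmorph /= Py star0 rmorph0.
- move=> y yP; apply: contfunP => z; apply: modc0_eq; apply/eqP.
  rewrite eq_le modc_ge0 andbT; apply/ler_addgt0Pr => e e0; rewrite add0r.
  have [w Pw yw] := yP e e0.
  have E : coef_tau (pi (y - w)) = coef_tau (pi y).
    have -> : coef_tau (pi (y - w)) = coef_tau (pi y) - coef_tau (pi w).
      by rewrite rmorphB.
    by rewrite Pw subr0.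
  have := modc_coef_tau_le (pi (y - w)) z; rewrite E => /le_trans; apply.
  apply: le_trans (ltW yw).
  exact: (starmorphism_contractive (pi : {starmorphism A -> (B : cstarAlgType R)})).
Qed.

(** In [x = \sum_k v k * (v k * x)] the factor [v k * x] is even, so each term is mapped to a pure
    [tau] element times a function. *)
Lemma coef1_odd x : odd_elt hv x -> coef1 (pi x) = 0.
Proof.
move=> Ox; rewrite -[x]mul1r (insert_unit hv).
apply: (big_ind (fun y => coef1 (pi y) = 0)) => [|y z Py Pz|k _].
- by rewrite rmorph0.
- by rewrite rmorphD /= Py Pz addr0.
- have Ek : coef_tau (pi (v k * x)) = 0 by apply: coef_tau_even; case: (Ox k).
  by rewrite mul1r rmorphM /= Ek pi_v /= mul0r rmorph0 mulr0 addr0.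
Qed.

Lemma even_kernel h : even_elt hv h -> star h = h -> pi h = 0 -> h = 0.
Proof.
move=> Eh sh pih; apply: contrapT => h0.
have Sh : sa_set (even_elt hv) h by split.
have [|chi [chiD chiM chi_cst chi_norm chih]] :=
    real_character (sa_cstar_norm (even_elt hv)) (h := sa_mk Sh).
  by move=> /(congr1 val) /= h0'; exact: h0.
have [v1 v2 v3] := hv.
pose V := cvalue chi.
have VU x w w' : V x w -> V x w' -> w = w' by exact: cvalue_unique.
have VM x y w w' : V x w -> V y w' -> V (x * y) (w * w') by exact: cvalueM.
have /choice[p' pV'] (ij : 'I_n.+1 * 'I_n.+1) : exists w, V (v ij.1 * v ij.2) w.
  by apply: cvalue_exists; exact: even_quadratic.
pose p i j := p' (i, j).
have pV i j : V (v i * v j) (p i j) := pV' (i, j).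
have [z z1 zE] : exists2 z : 'I_n.+1 -> C, \sum_i `|z i| ^+ 2 = 1 &
    forall i j, p i j = z i * (z j)^*.
  apply: rank_one.
  - apply: (VU 1); last exact: cvalue1.
    rewrite -v1; elim/big_ind2: _ => [||i _].
    + by have := cvalueZ chiD chiM chi_cst 0 (cvalue1 chi_cst); rewrite scale0r mul0r.
    + by move=> x w y w'; exact: cvalueD.
    + by rewrite expr2.
  - move=> i j; apply: (VU (v j * v i)) => //.
    by have := cvalue_star chiD (pV i j); rewrite starM !v2.
  (* The half-liberated relation rewrites [v i * v j * v k * v l] as [v k * v j * v i * v l]. *)
  - move=> i j k l; apply: (VU (v i * v j * (v k * v l))); first exact: VM.
    by rewrite mulrA v3 -mulrA; exact: VM.
pose zr : 'rV[C]_n.+1 := \row_i z i.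
have zrS : zr \in @complex_sphere C n.+1.
  by rewrite inE /complex_sphere /= -[RHS]z1; apply: eq_bigr => i _; rewrite mxE.
pose zs : csphere C n := exist _ zr zrS.
have zsE i : ccoord C i zs = z i by rewrite -[LHS]/(zr 0 i) mxE.
pose ev x := coef1 (pi x) zs.
(* The even elements on which the character agrees with evaluation at [zs] form a closed subalgebra
   containing the quadratic words, hence contain [h]. *)
pose P x := even_elt hv x /\ V x (ev x).
suff [S SP] : exists S : csub A, S = P :> (A -> Prop).
  have : S h.
    apply: gen_csub_ind Eh => _ [i [j ->]]; rewrite SP; split.
      exact: even_quadratic.
    rewrite /ev pi_quadratic /=.
    have -> : (ccoord C i * star (ccoord C j)) zs = z i * (z j)^*.
      by rewrite -!zsE.
    by rewrite -zE.
  rewrite SP => -[_]; rewrite /ev pih => Vh.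
  have := VU _ _ _ Vh (cvalue_sa chiD (sa_mk Sh)); rewrite -[LHS]/(0%:C%C).
  by move=> /complexI E; move: chih; rewrite -E eqxx.
have ev_norm x : modc (ev x) <= cnorm x.
  rewrite (le_trans (modc_coef1_le _ _))//.
  exact: (starmorphism_contractive (pi : {starmorphism A -> (B : cstarAlgType R)})).
unshelve eexists (@Csub _ _ P _ _ _ _ _ _); last by [].
- split; first exact: csub1.
  by rewrite /ev rmorph1; exact: cvalue1.
- move=> x y [Ex Vx] [Ey Vy]; split; first exact: csubD.
  by rewrite /ev rmorphD; exact: cvalueD.
- move=> x y [Ex Vx] [Ey Vy]; split; first exact: csubM.
  (* [coef1] is multiplicative here because the [tau] coefficient vanishes on even elements. *)
  rewrite /ev rmorphM coef1M (coef_tau_even Ex) mul0r addr0; exact: VM.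
- move=> a x [Ex Vx]; split; first exact: csubZ.
  by rewrite /ev linearZ; exact: cvalueZ.
- move=> x [Ex Vx]; split; first exact: csub_star.
  by rewrite /ev starmorph; exact: cvalue_star.
- move=> x xP; have Ex : even_elt hv x.
    by apply: csub_closed => e /xP[y [Ey _] xy]; exists y.
  split=> //; have [w Vw] := cvalue_exists chi Ex.
  suff -> : ev x = w by [].
  apply/subr0_eq/modc0_eq/eqP; rewrite eq_le modc_ge0 andbT.
  apply/ler_addgt0Pr => e e0; rewrite add0r.
  (* The three thirds pay for one [cnorm (x - y)] from [ev_norm] and two from [cvalue_norm]. *)
  have [|y [Ey Vy] xy] := xP (e / 3); first by lra.
  have -> : ev x - w = ev (x - y) - (w - ev y).
    have -> : ev (x - y) = ev x - ev y by rewrite /ev rmorphB.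
    by ring.
  have := modcD (ev (x - y)) (- (w - ev y)); rewrite modcN.
  have := ev_norm (x - y).
  have := cvalue_norm chi_norm (cvalueD chiD Vw (cvalueN chiD Vy)).
  by lra.
Qed.

End Injectivity.

Theorem theorem3p4 (R : realType) (n : nat)
    (A : cstarAlgType R) (v : 'I_n.+1 -> A)
    (hA : is_half_liberated_sphere v) :
  exists pi : {starmorphism A -> crossed_product (@conj_autK R[i] n)},
    injective pi /\
    forall i : 'I_n.+1, pi (v i) = tensor_tau (@conj_autK R[i] n) (ccoord R[i] i).
Proof.
have [hv univ] := hA.
pose w i := tensor_tau (@conj_autK R[i] n) (ccoord R[i] i).
(* The norm [crossed_norm] makes the crossed product an admissible target of the universal
   property. *)
have [|pi [piv _]] := univ _ w.
  have tau_star (i : 'I_n.+1) : @conj_aut R[i] n (star (ccoord R[i] i)) = ccoord R[i] i.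
    by rewrite -conj_aut_ccoord conj_autK.
  split=> [|i|i j k].
  - have E i : w i ^+ 2 =
        tensor1 (@conj_autK R[i] n) (ccoord R[i] i * star (ccoord R[i] i)).
      by rewrite expr2 tensor_tauM conj_aut_ccoord.
    have D : {morph tensor1 (@conj_autK R[i] n) : f g / f + g}.
      by move=> f g; apply: crossedP; rewrite /= ?addr0.
    under eq_bigr do rewrite E.
    rewrite -(big_morph _ D erefl); congr tensor1; apply: contfunP => z.
    rewrite (big_morph (fun f : contfun _ _ => f z) (fun _ _ => erefl) erefl).
    rewrite -[RHS](set_valP z); apply: eq_bigr => i _.
    by rewrite normCK.
  - by rewrite /w star_tensor_tau tau_star.
  (* Both sides are a function tensor [tau], the function [z_i * z_j^* * z_k] being symmetric in [i]
     and [k]. *)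
  - rewrite /w !tensor_tauM !tensor1_tauM !conj_aut_ccoord.
    by congr tensor_tau; rewrite mulrAC [_ * ccoord _ k]mulrC mulrAC.
exists pi; split => // x y /eqP; rewrite -subr_eq0 -rmorphB => /eqP pixy.
apply/subr0_eq; have [e [ o [Ee Oo xyE]]] := even_odd_decomposition hA (x - y).
(* The images of [e] and [o] lie in complementary summands, so they vanish separately. *)
have [pie pio] : pi e = 0 /\ pi o = 0.
  have eo : pi e + pi o = 0 by rewrite -rmorphD -xyE.
  have Ete := coef_tau_even piv Ee; have E1o := coef1_odd piv Oo.
  have H1 := congr1 (@Defs.coef1 _ _ _ _) eo; have H2 := congr1 (@coef_tau _ _ _ _) eo.
  rewrite /= E1o addr0 in H1; rewrite /= Ete add0r in H2.
  by split; apply: crossedP.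
(* [star z * z] is even for [z] even or odd, so the C*-identity reduces both cases to
   [even_kernel]. *)
have star_sqr0 z : even_elt hv (star z * z) -> pi z = 0 -> z = 0.
  move=> Ez piz; apply: cnorm_eq0; apply/eqP; rewrite -sqrf_eq0 -cnorm_star.
  rewrite (even_kernel piv Ez) ?cnorm0 //; first by rewrite starM starK.
  by rewrite rmorphM /= piz mulr0.
have e0 : e = 0.
  exact: star_sqr0 (csubM (csub_star Ee) Ee) pie.
have o0 : o = 0.
  exact: star_sqr0 (oddMM (odd_star Oo) Oo) pio.
by rewrite xyE e0 o0 addr0.
Qed.
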